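(* Let $K$ be an infinite field, $\mathsf{M}$ a matroid on $[n]$ without loops, $E=K\langle e_1,\dots,e_n\rangle$ and $J$ the Orlik–Solomon ideal of $\mathsf{M}$. Then $\operatorname{depth}E/J=1$ if and only if $\beta(\mathsf{M})\neq0$.
   Context: A matroid on $[n]$ is a nonempty family of subsets of $[n]$ (independent sets) containing $\emptyset$, closed under subsets, satisfying the exchange axiom; other subsets are dependent; a loop is an $i$ with $\{i\}$ dependent. The rank $r(X)$ of $X\subseteq[n]$ is the maximal size of an independent subset of $X$, and $r(\mathsf{M})=r([n])$. The beta-invariant is $\beta(\mathsf{M})=(-1)^{r(\mathsf{M})}\sum_{S\subseteq[n]}(-1)^{|S|}r(S)$. $E$ is the standard graded exterior algebra; for $S=\{i_0<\dots<i_m\}$, $e_S=e_{i_0}\wedge\dots\wedge e_{i_m}$ and $\partial e_S=\sum_{j=0}^m(-1)^je_{S\setminus\{i_j\}}$; the Orlik–Solomon ideal is $J=(\partial e_S:S\text{ dependent})$. For a graded module $N$, $v\in E_1$ is $N$-regular if $0:_Nv=vN$; a sequence $v_1,\dots,v_s\in E_1$ is $N$-regular if $v_i$ is $N/(v_1,\dots,v_{i-1})N$-regular for each $i$ and $N/(v_1,\dots,v_s)N\neq0$; $\operatorname{depth}N$ is the common length of maximal $N$-regular sequences. *)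

(* Defs.v *)
From HB Require Import structures.
From mathcomp Require Import all_boot all_order all_algebra all_field.

Set Implicit Arguments.
Unset Strict Implicit.
Unset Printing Implicit Defensive.

Import GRing.Theory.
Local Open Scope ring_scope.
Local Open Scope quotient_scope.

Record matroid (n : nat) := Matroid {
  indep : {set {set 'I_n}};
  indep0 : set0 \in indep;
  indepS : forall X Y : {set 'I_n}, X \subset Y -> Y \in indep -> X \in indep;
  indep_exchange : forall X Y : {set 'I_n},
    X \in indep -> Y \in indep -> (#|X| < #|Y|)%N ->
    exists2 i, i \in Y :\: X & i |: X \in indep
}.

Section MatroidTheory.
Variables (n : nat) (M : matroid n).

Definition loopless := forall i : 'I_n, [set i] \in indep M.

Definition rank (X : {set 'I_n}) : nat :=
  \max_(I in indep M | I \subset X) #|I|.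

Definition beta : int :=
  (-1) ^+ rank [set: 'I_n] * \sum_(S : {set 'I_n}) (-1) ^+ #|S| * (rank S)%:Z.

End MatroidTheory.

(* An element is the family of its coordinates on the basis of the increasing
   monomials [e_S]; the product is determined by [e_A * e_B = +/- e_(A :|: B)]
   for disjoint [A] and [B], the sign being that of the permutation sorting the
   concatenation of [A] and [B], and [e_A * e_B = 0] otherwise.
   The alias shields this product from the pointwise one of [{ffun _ -> _}]. *)
Definition exterior (K : fieldType) (n : nat) := {ffun {set 'I_n} -> K^o}.

HB.instance Definition _ K n := Vector.on (exterior K n).

Definition inversions (n : nat) (A B : {set 'I_n}) : nat :=
  \sum_(i in A) \sum_(j in B) (j < i)%N.

Section ExteriorRing.
Variables (K : fieldType) (n : nat).
Local Notation E := (exterior K n).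
Implicit Types (x y z : E) (A B C S : {set 'I_n}).

Definition ext_one : E := [ffun S => (S == set0)%:R].
Definition ext_mul x y : E :=
  [ffun S : {set 'I_n} => \sum_(A : {set 'I_n} | A \subset S)
     (-1) ^+ inversions A (S :\: A) * (x A : K) * (y (S :\: A) : K)].

Lemma inversions0l B : inversions set0 B = 0%N.
Proof. by rewrite /inversions big_set0. Qed.

Lemma inversions0r A : inversions A set0 = 0%N.
Proof. by rewrite /inversions big1 // => i _; rewrite big_set0. Qed.

Lemma inversionsUl A B C : [disjoint A & B] ->
  inversions (A :|: B) C = (inversions A C + inversions B C)%N.
Proof.
move=> dAB; rewrite /inversions -bigU //.
by apply: eq_bigl => i; rewrite !inE.
Qed.

Lemma inversionsUr A B C : [disjoint B & C] ->
  inversions A (B :|: C) = (inversions A B + inversions A C)%N.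
Proof.
move=> dBC; rewrite /inversions -big_split /=.
apply: eq_bigr => i _; rewrite -bigU //.
by apply: eq_bigl => j; rewrite !inE.
Qed.

Lemma ext_mulA : associative ext_mul.
Proof.
move=> x y z; apply/ffunP=> S; rewrite !ffunE.
under eq_bigr => A _ do rewrite ffunE mulr_sumr.
under [RHS]eq_bigr => D _ do rewrite ffunE mulr_sumr mulr_suml.
rewrite [RHS](exchange_big_dep (fun A => A \subset S)) /=; last first.
  by move=> D A sDS sAD; apply: subset_trans sAD sDS.
apply: eq_bigr => A sAS.
rewrite [RHS](reindex_onto (fun B => A :|: B) (fun D => D :\: A)) /=; last first.
  move=> D /andP[_ sAD]; apply/setP=> i; rewrite !inE.
  by case: (boolP (i \in A)) => //= /(subsetP sAD) ->.
have PP B : (B \subset S :\: A) =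
  ((A :|: B \subset S) && (A \subset A :|: B)) && ((A :|: B) :\: A == B).
  rewrite subsetUl andbT subUset sAS /= subsetD; congr (_ && _).
  rewrite setDUl setDv set0U; apply/idP/eqP => [/setDidPl //| <-].
  by rewrite disjoints_subset subsetDr.
rewrite (eq_bigl _ _ PP); apply: eq_bigr => B; rewrite -PP => sB.
have dAB : [disjoint A & B].
  by rewrite disjoint_sym; move: sB; rewrite subsetD => /andP[].
have -> : (A :|: B) :\: A = B.
  by rewrite setDUl setDv set0U; apply/setDidPl; rewrite disjoint_sym.
rewrite -setDDl; set C := S :\: A :\: B.
have dBC : [disjoint B & C] by rewrite disjoint_sym disjoints_subset subsetDr.
have -> : S :\: A = B :|: C.
  by rewrite -[LHS](setID _ B) (setIidPr sB).
rewrite (inversionsUl _ dAB) (inversionsUr _ dBC) !exprD.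
rewrite !mulrA; congr (_ * _ * _); rewrite [LHS]mulrAC; congr (_ * _).
by rewrite -[LHS]mulrA mulrC.
Qed.

Lemma ext_mul1r : left_id ext_one ext_mul.
Proof.
move=> x; apply/ffunP=> S; rewrite ffunE (bigD1 set0) ?sub0set //= big1.
  by rewrite ffunE eqxx inversions0l setD0 expr0 !mul1r addr0.
by move=> A /andP[_ /negPf nA]; rewrite ffunE nA mulr0 mul0r.
Qed.

Lemma ext_mulr1 : right_id ext_one ext_mul.
Proof.
move=> x; apply/ffunP=> S; rewrite ffunE (bigD1 S) //= big1.
  by rewrite ffunE setDv eqxx inversions0r expr0 mul1r mulr1 addr0.
move=> A /andP[sAS nA]; rewrite ffunE setD_eq0.
have /negPf-> : ~~ (S \subset A) by move: nA; rewrite eqEsubset sAS.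
by rewrite mulr0.
Qed.

Lemma ext_mulDl : left_distributive ext_mul +%R.
Proof.
move=> x y z; apply/ffunP=> S; rewrite !ffunE -big_split /=.
by apply: eq_bigr => A _; rewrite ffunE mulrDr mulrDl.
Qed.

Lemma ext_mulDr : right_distributive ext_mul +%R.
Proof.
move=> x y z; apply/ffunP=> S; rewrite !ffunE -big_split /=.
by apply: eq_bigr => A _; rewrite ffunE mulrDr.
Qed.

Lemma ext_one_neq0 : ext_one != 0.
Proof.
by apply/eqP=> /ffunP/(_ set0); rewrite !ffunE eqxx => /eqP; rewrite oner_eq0.
Qed.

Lemma ext_scaleAl (k : K) x y : k *: ext_mul x y = ext_mul (k *: x) y.
Proof.
apply/ffunP=> S; rewrite !ffunE scaler_sumr; apply: eq_bigr => A _.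
by rewrite ffunE /GRing.scale /= !mulrA (mulrC k).
Qed.

Lemma ext_scaleAr (k : K) x y : k *: ext_mul x y = ext_mul x (k *: y).
Proof.
apply/ffunP=> S; rewrite !ffunE scaler_sumr; apply: eq_bigr => A _.
by rewrite ffunE /GRing.scale /= mulrCA.
Qed.

End ExteriorRing.

HB.instance Definition _ (K : fieldType) n :=
  GRing.Zmodule_isNzRing.Build (exterior K n) (@ext_mulA K n)
    (@ext_mul1r K n) (@ext_mulr1 K n) (@ext_mulDl K n) (@ext_mulDr K n)
    (@ext_one_neq0 K n).
HB.instance Definition _ (K : fieldType) n :=
  GRing.Lmodule_isLalgebra.Build K (exterior K n) (@ext_scaleAl K n).
HB.instance Definition _ (K : fieldType) n :=
  GRing.Lalgebra_isAlgebra.Build K (exterior K n) (@ext_scaleAr K n).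
HB.instance Definition _ (K : fieldType) n :=
  Algebra_isFalgebra.Build K (exterior K n).

Section ExteriorElements.
Variables (K : fieldType) (n : nat).
Local Notation E := (exterior K n).

Definition ext_gen (i : 'I_n) : E := [ffun S => (S == [set i])%:R].

(* [enum S] lists [S] in increasing order. *)
Definition ext_mon (S : {set 'I_n}) : E := \prod_(i <- enum S) ext_gen i.

Definition ext_bd (S : {set 'I_n}) : E :=
  \sum_(i in S) (-1) ^+ #|[set k in S | (k < i)%N]| *: ext_mon (S :\ i).

Definition ext_deg1 (v : E) :=
  forall S : {set 'I_n}, v S != 0 -> #|S| = 1%N.

Lemma ext_monE (S : {set 'I_n}) :
  ext_mon S = [ffun T => (T == S)%:R] :> E.
Proof.
have mulE (x y : E) : x * y = ext_mul x y by [].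
rewrite /ext_mon; have : sorted ltn (map val (enum S)).
  rewrite sorted_map /enum_mem; apply: sorted_filter.
    by move=> j i k; apply: ltn_trans.
  by have := iota_ltn_sorted 0 n; rewrite -val_enum_ord sorted_map enumT.
rewrite -[in RHS](set_enum S); elim: (enum S) => [_|i s IHs] /=.
  have -> : [set i in [::]] = set0 :> {set 'I_n}.
    by apply/setP=> i; rewrite !inE.
  by rewrite big_nil.
move=> s_lt; have lt_i j : j \in s -> (i < j)%N.
  move=> sj; move: s_lt; rewrite path_sortedE; last exact: ltn_trans.
  by case/andP=> /allP/(_ (val j)) + _; rewrite map_f //; apply.
have s_i : i \notin s by apply/negP=> /lt_i; rewrite ltnn.
rewrite big_cons {}IHs ?(path_sorted s_lt) // mulE.
apply/ffunP=> T; rewrite !ffunE set_cons.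
have [Ti | T'i] := boolP (i \in T); last first.
  rewrite big1 => [|A sAT]; last first.
    rewrite !ffunE; case: eqP sAT => [->|_ _]; last by rewrite mulr0 mul0r.
    by rewrite sub1set (negPf T'i).
  by case: eqP T'i => // ->; rewrite !inE eqxx.
rewrite (bigD1 [set i]) ?sub1set //= big1 => [|A /andP[_ /negPf nA]]; last first.
  by rewrite !ffunE nA mulr0 mul0r.
rewrite !ffunE eqxx mulr1 addr0.
have -> : (T == i |: [set x in s]) = (T :\ i == [set x in s]).
  apply/eqP/eqP => [->|<-]; last by rewrite setD1K.
  by rewrite setU1K // inE.
case: eqP => [-> | _]; last by rewrite mulr0.
rewrite mulr1 /inversions big_set1 big1 // => j; rewrite inE => /lt_i.
by move=> /ltnW le_ij; rewrite ltnNge le_ij.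
Qed.

End ExteriorElements.

Section IdealQuotient.
Variables (K : fieldType) (A : falgType K) (X : seq A).

Definition ideal_gen : {vspace A} := (fullv * <<X>> * fullv)%VS.

Definition quot_by := Quotient.quot ideal_gen.

HB.instance Definition _ := GRing.Zmodule.on quot_by.
HB.instance Definition _ :=
  EqQuotient.copy quot_by (Quotient.quot ideal_gen).

Lemma ideal_genMl (a x : A) : x \in ideal_gen -> a * x \in ideal_gen.
Proof.
move=> xI; have /subvP : (fullv * ideal_gen <= ideal_gen)%VS.
  by rewrite /ideal_gen !prodvA; apply: prodvSl; apply: prodvSl; apply: subvf.
by apply; apply: memv_mul (memvf a) xI.
Qed.

Lemma quot_by_eq (x y : A) :
  (x == y %[mod quot_by]) = (x - y \in ideal_gen).
Proof. by rewrite -Quotient.idealrBE. Qed.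

Definition quot_by_scale (a : A) (u : quot_by) : quot_by :=
  \pi_quot_by (a * repr u).

Lemma quot_by_scale_pi (a x : A) :
  quot_by_scale a (\pi_quot_by x) = \pi_quot_by (a * x).
Proof.
apply/eqP; rewrite quot_by_eq -mulrBr; apply: ideal_genMl.
by rewrite -quot_by_eq reprK.
Qed.

Lemma quot_by_reprK (u : quot_by) : \pi_quot_by (repr u) = u.
Proof. exact: reprK. Qed.

Lemma quot_by_piD (x y : A) :
  \pi_quot_by (x + y) = \pi_quot_by x + \pi_quot_by y.
Proof. exact: (@pi_addr _ _ _ _ _ (Quotient.quot ideal_gen)). Qed.

Lemma quot_by_scaleA (a b : A) (u : quot_by) :
  quot_by_scale a (quot_by_scale b u) = quot_by_scale (a * b) u.
Proof. by rewrite -[u]quot_by_reprK !quot_by_scale_pi mulrA. Qed.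

Lemma quot_by_scale1 : left_id 1 quot_by_scale.
Proof. by move=> u; rewrite -[u]quot_by_reprK quot_by_scale_pi mul1r. Qed.

Lemma quot_by_scaleDr : right_distributive quot_by_scale +%R.
Proof.
move=> a u v; rewrite -[u]quot_by_reprK -[v]quot_by_reprK -quot_by_piD !quot_by_scale_pi.
by rewrite mulrDr quot_by_piD.
Qed.

Lemma quot_by_scaleDl (u : quot_by) :
  {morph quot_by_scale^~ u : a b / a + b}.
Proof.
by move=> a b; rewrite -[u]quot_by_reprK !quot_by_scale_pi mulrDl quot_by_piD.
Qed.

HB.instance Definition _ := GRing.Zmodule_isLmodule.Build A quot_by
  quot_by_scaleA quot_by_scale1 quot_by_scaleDr quot_by_scaleDl.

End IdealQuotient.

Section Depth.
Variables (K : fieldType) (n : nat).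
Local Notation E := (exterior K n).
Variable N : lmodType E.
Implicit Types (v : E) (vs : seq E).

(* The submodule [(v_1, ..., v_s) N]. As the [v_i] have degree 1, the left and
   the two-sided ideal they generate coincide, and [E v_i N = v_i N]. *)
Definition seq_mulmod vs (x : N) :=
  exists y : 'I_(size vs) -> N, x = \sum_(i < size vs) vs`_i *: y i.

(* [v] is regular on [N / L], for a submodule [L] of [N]: the two sides of
   [0 :_(N/L) v = v (N/L)], read on representatives. *)
Definition regular_on_quot (L : N -> Prop) v :=
  forall x : N, L (v *: x) <-> exists y : N, L (x - v *: y).

Definition regular_seq vs :=
  (forall i, (i < size vs)%N ->
     ext_deg1 vs`_i /\ regular_on_quot (seq_mulmod (take i vs)) vs`_i)
  /\ (exists x : N, ~ seq_mulmod vs x).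

Definition maximal_regular_seq vs :=
  regular_seq vs /\ forall v, ~ regular_seq (rcons vs v).

(* Relational: [d] is the common length of all maximal [N]-regular sequences. *)
Definition depth_eq (d : nat) :=
  (exists vs, maximal_regular_seq vs)
  /\ (forall vs, maximal_regular_seq vs -> size vs = d).

End Depth.

Section OrlikSolomon.
Variables (K : fieldType) (n : nat) (M : matroid n).

Definition OS_relations : seq (exterior K n) :=
  [seq ext_bd K D | D in ~: indep M].

Definition OS_ideal : {vspace exterior K n} := ideal_gen OS_relations.

Definition OS_algebra : lmodType (exterior K n) := quot_by OS_relations.

End OrlikSolomon.

(* Main.v *)
Require Import Defs.
From HB Require Import structures.
From mathcomp Require Import all_boot all_order all_algebra all_field.
From mathcomp Require Import zify ring.

Set Implicit Arguments.
Unset Strict Implicit.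
Unset Printing Implicit Defensive.

Import GRing.Theory Num.Theory.
Local Open Scope ring_scope.

(* For weights [c], the interior product [d_c] is the antiderivation of [E] with
   [d_c e_i = c_i].  If [d_c] preserves a left ideal [L] and [c_i = 1], then
   [d_c] is a contracting homotopy for multiplication by [e_i], so [e_i] is
   regular on [E/L].  With [c = 1] every [e_i] is regular on [E/J].  If [M] is a
   direct sum along [X], the indicator of [X] also preserves [J], and [e_j, e_i]
   with [j] outside and [i] inside [X] is a regular sequence.  By Crapo's theorem
   such an [X] exists when [beta M = 0], because a connected matroid has a
   connected deletion or contraction.

   Conversely, regularity of [v] divides the Hilbert series [H] by [1 + t], so a
   regular sequence of length 2 gives [H'(-1) = 0].  Finally [H'(-1)] is [beta M]
   up to sign: [J] is graded by the flats of [M], [E/J] lives in degree [r(Y)]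
   over the flat [Y], and the part of [J] over each flat has as many even as odd
   dimensions, by induction on flats, since [d_1 + e_i] is an involution
   exchanging the parities of the part of [J] supported below a flat [X]
   containing [i]. *)

(** * Crapo's theorem *)

Section Crapo.
Variable T : finType.
Implicit Types (f : {set T} -> nat) (A B G S X Y : {set T}) (e : T).

(* The value at [set0] is arbitrary, so that contracting [e] is substituting [e |: S]. *)
Definition rank_function f :=
  [/\ forall A B, A \subset B -> (f A <= f B)%N,
      forall A B, (f (A :|: B) + f (A :&: B) <= f A + f B)%N
    & forall e A, (f (e |: A) <= (f A).+1)%N].

Definition contract f e S := f (e |: S).

Definition crapo_sum f G : int := \sum_(S : {set T} | S \subset G) (-1) ^+ #|S| * (f S)%:Z.

(** The beta invariant of [G] for the rank [f - f set0]: the exponent has the parity of that rank,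
    and the constant [f set0] cancels in the sum when [G] is nonempty. *)
Definition crapo f G : int := (-1) ^+ (f G + f set0)%N * crapo_sum f G.

Definition separates f G X :=
  [&& X \subset G, X != set0, X != G & (f X + f (G :\: X) == f G + f set0)%N].

Lemma contract_rank_function f e : rank_function f -> rank_function (contract f e).
Proof.
case=> mono submod unit; rewrite /contract; split=> [A B sAB|A B|i A].
- by apply: mono; apply: setUS.
- by have := submod (e |: A) (e |: B); rewrite -setUUr -setUIr.
- by have := unit i (e |: A); rewrite setUCA.
Qed.

Lemma big_subset_set0 (R : nmodType) (F : {set T} -> R) :
  \sum_(S : {set T} | S \subset set0) F S = F set0.
Proof. by rewrite (eq_bigl (pred1 set0)) ?big_pred1_eq // => S; rewrite /= subset0. Qed.

Lemma big_subset_setD1 (R : nmodType) (F : {set T} -> R) e G : e \in G ->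
  \sum_(S : {set T} | S \subset G) F S =
  \sum_(S : {set T} | S \subset G :\ e) F S + \sum_(S : {set T} | S \subset G :\ e) F (e |: S).
Proof.
move=> Ge; rewrite (bigID (fun S => e \notin S)) /=; congr (_ + _).
  by apply: eq_bigl => S; rewrite subsetD1.
rewrite (reindex_onto (fun S => e |: S) (fun S => S :\ e)) /=; last first.
  by move=> S /andP[_ /negPn/setD1K].
apply: eq_bigl => S; rewrite subsetD1 negbK setU11 andbT subUset sub1set Ge /=.
congr (_ && _); apply/eqP/idP => [<-|nSe]; first by rewrite setD11.
by rewrite setU1K.
Qed.

Lemma crapo_sum_setD1 f e G : e \in G ->
  crapo_sum f G = crapo_sum f (G :\ e) - crapo_sum (contract f e) (G :\ e).
Proof.
move=> Ge; rewrite /crapo_sum (big_subset_setD1 _ Ge); congr (_ + _).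
rewrite -sumrN; apply: eq_bigr => S; rewrite subsetD1 => /andP[_ nSe].
by rewrite cardsU1 nSe exprS mulN1r mulNr.
Qed.

Lemma crapo_sum_cst (k : nat) G :
  G != set0 -> crapo_sum (fun=> k) G = 0.
Proof. by case/set0Pn=> e Ge; rewrite (crapo_sum_setD1 _ Ge) subrr. Qed.

Section RankFunction.
Variables (f : {set T} -> nat) (f_rank : rank_function f).

Let mono A B : A \subset B -> (f A <= f B)%N.
Proof. by case: f_rank => /(_ A B). Qed.
Let submod A B : (f (A :|: B) + f (A :&: B) <= f A + f B)%N.
Proof. by case: f_rank => _ /(_ A B). Qed.
Let unit e A : (f (e |: A) <= (f A).+1)%N.
Proof. by case: f_rank => _ _ /(_ e A). Qed.

Lemma crapo_set1 e : crapo f [set e] = (f [set e] != f set0).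
Proof.
have := unit e set0; have := mono (sub0set [set e]); rewrite setU0 => le1 le2.
rewrite /crapo (@crapo_sum_setD1 f e _ (set11 e)) setDv /crapo_sum.
rewrite !big_subset_set0 cards0 expr0 !mul1r /contract setU0.
have [->|neq] := eqVneq (f [set e]) (f set0); first by rewrite subrr mulr0.
have -> : f [set e] = (f set0).+1 by lia.
rewrite addSn addnn -addn1 exprD -mul2n exprM sqrrN !expr1n mul1r expr1.
by lia.
Qed.

Lemma separates_loop G X : X \subset G -> X != set0 -> X != G -> f X = f set0 ->
  separates f G X.
Proof.
move=> sXG X0 XG fX; apply/and4P; split => //.
have := submod X (G :\: X); rewrite setIDA setIC -setIDA setDv setI0 fX.
rewrite -{1}(setIidPr sXG) setID.
have := mono (subsetDl G X); lia.
Qed.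

(** Deletion-contraction: contracting lowers the rank by one, which turns the difference of
    alternating sums into a sum. For a loop or a coloop the two alternating sums agree. *)
Lemma crapo_setD1 e G : e \in G -> G :\ e != set0 ->
  crapo f G = if (f [set e] == f set0) || (f G != f (G :\ e)) then 0
              else crapo f (G :\ e) + crapo (contract f e) (G :\ e).
Proof.
move=> Ge G'0; rewrite /crapo (crapo_sum_setD1 _ Ge).
have fe S : e \notin S -> (f (e |: S) + f set0 <= f S + f [set e])%N.
  move=> nSe; have := submod [set e] S; rewrite addnC [X in (_ <= X)%N]addnC.
  suff -> : [set e] :&: S = set0 by lia.
  by apply/setP=> i; rewrite !inE; case: eqP => // ->; rewrite (negPf nSe).
have le1 := unit e set0; have le2 := unit e (G :\ e).
rewrite setU0 setD1K // in le1 le2.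
case: eqP => [loop|nloop] /=.
  suff -> : crapo_sum (contract f e) (G :\ e) = crapo_sum f (G :\ e).
    by rewrite subrr mulr0.
  apply: eq_bigr => S; rewrite subsetD1 => /andP[sSG /fe]; rewrite /contract.
  have := mono (subsetUr [set e] S) => le3 le4.
  by have -> : f (e |: S) = f S by lia.
case: eqP => [eqG|neqG] /=.
  rewrite -eqG /contract setU0 setD1K // mulrBr; congr (_ + _).
  have -> : f [set e] = (f set0).+1.
    have := mono (sub0set [set e]); lia.
  by rewrite addnS exprS mulN1r mulNr.
have coloop S : S \subset G :\ e -> f (e |: S) = (f S).+1.
  move=> sS; have := submod (e |: S) (G :\ e); rewrite -setUA (setUidPr sS).
  rewrite setD1K //.
  have -> : (e |: S) :&: (G :\ e) = S.
    apply/setP=> i; rewrite !inE; case: eqP => [->|_] /=.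
      by apply/esym/negbTE/negP => /(subsetP sS); rewrite !inE eqxx.
    by case: (boolP (i \in S)) => //= /(subsetP sS); rewrite !inE => /andP[].
  have := unit e S; have := mono (subsetDl G [set e]); lia.
(* The two sums differ by the alternating sum of the constant 1 over the subsets of a nonempty
   set. *)
suff -> : crapo_sum (contract f e) (G :\ e) = crapo_sum f (G :\ e).
  by rewrite subrr mulr0.
rewrite -[RHS]addr0 -(crapo_sum_cst 1 G'0) -big_split /=.
apply: eq_bigr => S sS; rewrite /contract coloop // -mulrDr; congr (_ * _).
by lia.
Qed.

(** Uncrossing a separation [A, C] of the deletion with a separation [B, D] of the contraction. In
    [G] the complement of [A :&: B] is [C :|: (e |: D)], that of [C :&: D] is [A :|: (e |: B)], and
    one of the two intersections separates. *)
Lemma separates_uncross e G A B C D : e \in G ->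
  A :|: C = G :\ e -> A :&: C = set0 -> B :|: D = G :\ e -> B :&: D = set0 ->
  (f A + f C = f G + f set0)%N -> (f (e |: B) + f (e |: D) <= f G + (f set0).+1)%N ->
  A :&: B != set0 -> C :&: D != set0 -> exists Z, separates f G Z.
Proof.
move=> Ge AC AC0 BD BD0 eAC leBD nAB nCD.
have sep (U V U' V' : {set T}) : U :|: U' = G :\ e -> U :&: U' = set0 ->
    V :|: V' = G :\ e -> V :&: V' = set0 -> U :&: V != set0 ->
    (f (U :&: V) + f (U' :|: (e |: V')) <= f G + f set0)%N ->
    separates f G (U :&: V).
  move=> UU UU0 VV VV0 n0 le.
  have dI i : [&& (i \in U) || (i \in U') == (i \in G :\ e),
     ~~ ((i \in U) && (i \in U')), (i \in V) || (i \in V') == (i \in G :\ e)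
     & ~~ ((i \in V) && (i \in V'))].
    have /setP/(_ i) := UU; have /setP/(_ i) := UU0; have /setP/(_ i) := VV.
    by have /setP/(_ i) := VV0; rewrite !inE => -> -> -> ->; rewrite !eqxx.
  have EUV : G :\: (U :&: V) = U' :|: (e |: V').
    apply/setP=> i; rewrite !inE; have := dI i; rewrite !inE.
    have [->|_] := eqVneq i e; first by rewrite Ge; do 4![case: (_ \in _)].
    by do 5![case: (_ \in _)].
  have sUV : U :&: V \subset G.
    apply/subsetP=> i; rewrite !inE; have := dI i; rewrite !inE.
    by case: (i != e); do 5![case: (_ \in _)].
  have nUVe : e \notin U :&: V.
    by have := dI e; rewrite !inE eqxx; do 4![case: (_ \in _)].
  apply/and4P; split=> //; first by apply: contraNneq nUVe => ->.
  have := submod (U :&: V) (G :\: (U :&: V)).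
  rewrite -{1}(setIidPr sUV) setID EUV.
  suff -> : U :&: V :&: (U' :|: (e |: V')) = set0 by lia.
  by rewrite -EUV setIDA setIC -setIDA setDv setI0.
have s1 := submod A (e |: B); have s2 := submod C (e |: D).
have nI (U U' V : {set T}) : U :|: U' = G :\ e -> U :&: (e |: V) = U :&: V.
  move=> UU; apply/setP=> i; rewrite !inE; have [->|//] := eqVneq i e.
  case: (boolP (e \in U)) => // eU.
  by have := setD11 e G; rewrite -UU inE eU.
have CA : C :|: A = G :\ e by rewrite setUC.
have DB : D :|: B = G :\ e by rewrite setUC.
rewrite (nI _ _ _ AC) in s1; rewrite (nI _ _ _ CA) in s2.
(* By [s1] and [s2] the rank sums of the two complementary pairs add up to at most
   [2 * (f G + f set0) + 1], so one of them is at most [f G + f set0]. *)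
have [le|lt] := leqP (f (A :&: B) + f (C :|: (e |: D))) (f G + f set0).
  by exists (A :&: B); apply: (sep _ _ _ _ AC AC0 BD BD0).
exists (C :&: D); apply: (sep _ _ _ _ CA _ DB) => //; [by rewrite setIC | by rewrite setIC | lia].
Qed.

(* Contrapositive of Tutte's theorem: a connected matroid has a connected deletion
   or contraction. *)
Lemma separates_minors e G X P : e \in G -> f G = f (G :\ e) ->
  separates f (G :\ e) X -> separates (contract f e) (G :\ e) P ->
  exists Z, separates f G Z.
Proof.
move=> Ge fGe; have := unit e set0; rewrite setU0 => le1.
case/and4P=> sX X0 XG /eqP; rewrite -fGe => sepX.
case/and4P=> sP P0 PG /eqP; rewrite /contract setU0 setD1K // => sepP.
have part (Z : {set T}) : Z \subset G :\ e -> Z != G :\ e -> exists W, [/\ W != set0,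
    (G :\ e) :\: Z = W, Z :|: W = G :\ e & Z :&: W = set0].
  move=> sZ nZ; exists ((G :\ e) :\: Z); split=> //.
  - by rewrite setD_eq0; apply: contra nZ => sGZ; rewrite eqEsubset sZ.
  - by rewrite -{1}(setIidPr sZ) setID.
  - by rewrite setIDA setIC -setIDA setDv setI0.
have [Y [Y0 EY XY XY0]] := part X sX XG; have [Q [Q0 EQ PQ PQ0]] := part P sP PG.
rewrite EY in sepX; rewrite EQ in sepP.
have le2 : (f (e |: P) + f (e |: Q) <= f G + (f set0).+1)%N by lia.
have le3 : (f (e |: Q) + f (e |: P) <= f G + (f set0).+1)%N by lia.
have QP : Q :|: P = G :\ e by rewrite setUC.
have QP0 : Q :&: P = set0 by rewrite setIC.
have empty (A B D : {set T}) : A \subset G :\ e -> B :|: D = G :\ e -> A != set0 ->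
    A :&: B = set0 -> A :&: D != set0.
  move=> sA BD nA AB; apply: contraNneq nA => AD.
  by rewrite -(setIidPl sA) -BD setIUr AB AD setU0.
have sY : Y \subset G :\ e by rewrite -XY subsetUr.
have sQ : Q \subset G :\ e by rewrite -PQ subsetUr.
have YX : Y :|: X = G :\ e by rewrite setUC.
have unc1 := separates_uncross Ge XY XY0 PQ PQ0 sepX le2.
have unc2 := separates_uncross Ge XY XY0 QP QP0 sepX le3.
(* Either [X, Y] meet [P, Q] respectively, or they meet [Q, P] respectively: an empty intersection
   in one matching makes both intersections in the other nonempty. *)
have [XP|XP] := eqVneq (X :&: P) set0; have [YP|YP] := eqVneq (Y :&: P) set0.
- have := empty P X Y sP XY P0; rewrite !(setIC P) XP YP eqxx => /(_ erefl) //.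
- by apply: unc2 => //; apply: (empty X P).
- have [YQ|YQ] := eqVneq (Y :&: Q) set0; last exact: unc1.
  by have := empty Y P Q sY PQ Y0 YP; rewrite YQ eqxx.
- have [YQ|YQ] := eqVneq (Y :&: Q) set0; last exact: unc1.
  apply: unc2 => //; rewrite setIC; apply: (empty Q Y X) => //.
  by rewrite setIC.
Qed.
End RankFunction.

(** Nonnegativity lets a vanishing sum in the deletion-contraction rule force both terms to
    vanish. *)
Lemma crapo_ge0 f G : rank_function f -> 0 <= crapo f G.
Proof.
have [m] := ubnP #|G|; elim: m f G => // m IHm f G ltGm f_rank.
have [->|/set0Pn[e Ge]] := eqVneq G set0.
  rewrite /crapo /crapo_sum big_subset_set0.
  by rewrite cards0 expr0 mul1r addnn -mul2n exprM sqrrN !expr1n mul1r.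
have [G'0|G'0] := eqVneq (G :\ e) set0.
  have -> : G = [set e] by rewrite -(setD1K Ge) G'0 setU0.
  by rewrite crapo_set1.
rewrite (crapo_setD1 f_rank Ge G'0); case: ifP => // _; apply: addr_ge0; apply: IHm => //.
- by rewrite (cardsD1 e G) Ge in ltGm.
- by rewrite (cardsD1 e G) Ge in ltGm.
- exact: contract_rank_function.
Qed.

(** Induction by deletion-contraction: a loop or a coloop separates alone; otherwise both minors
    have invariant zero and [separates_minors] combines their separations. The condition on [f G]
    excludes a single loop, whose invariant is zero. *)
Theorem crapo_eq0_separates f G : rank_function f -> f G != f set0 ->
  crapo f G = 0 -> exists X, separates f G X.
Proof.
have [m] := ubnP #|G|; elim: m f G => // m IHm f G ltGm f_rank nG crapo0.
have [|/set0Pn[e Ge]] := eqVneq G set0; first by move=> G0; rewrite G0 eqxx in nG.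
have [G'0|G'0] := eqVneq (G :\ e) set0.
  have Ge1 : G = [set e] by rewrite -(setD1K Ge) G'0 setU0.
  by move: crapo0; rewrite Ge1 crapo_set1 // -Ge1 nG.
have [mono submod unit] := f_rank.
have e_sep : ((f [set e]) + f (G :\ e) = f G + f set0)%N -> exists X, separates f G X.
  move=> sep; exists [set e]; rewrite /separates sub1set Ge sep eqxx andbT /=.
  apply/andP; split; first by apply/set0Pn; exists e; rewrite inE.
  by apply: contraNneq G'0 => <-; rewrite setDv.
have le1 := unit e set0; have le2 := unit e (G :\ e); rewrite setU0 setD1K // in le1 le2.
have le3 := mono _ _ (sub0set [set e]); have le4 := mono _ _ (subsetDl G [set e]).
have le5 := submod [set e] (G :\ e); rewrite setD1K // in le5.
have I0 : [set e] :&: (G :\ e) = set0 by rewrite setIDA setIC -setIDA setDv setI0.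
rewrite I0 in le5.
move: crapo0; rewrite (crapo_setD1 f_rank Ge G'0).
case: eqP => [loop _|nloop] /=; first by apply: e_sep; lia.
case: eqP => [eqG|neqG _] /=; last by apply: e_sep; lia.
have ltG'm : (#|G :\ e| < m)%N by rewrite (cardsD1 e G) Ge in ltGm.
have g1 := crapo_ge0 (G :\ e) f_rank.
have g2 := crapo_ge0 (G :\ e) (contract_rank_function e f_rank).
move=> /eqP; rewrite paddr_eq0 // => /andP[/eqP crapo1 /eqP crapo2].
have [|X sepX] := IHm f (G :\ e) ltG'm f_rank _ crapo1; first by rewrite -eqG.
(* A contraction of rank zero escapes the induction hypothesis. Then [G] has rank one, so one side
   of the separation [X] of the deletion has rank zero and separates [G]. *)
have [eq1|ne1] := eqVneq (contract f e (G :\ e)) (contract f e set0).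
  rewrite /contract setD1K // setU0 in eq1.
  have /and4P[sX X0 XG /eqP sepXe] := sepX.
  have sXG : X \subset G by apply: subset_trans sX (subsetDl _ _).
  have loop (Y : {set T}) : Y \subset G :\ e -> Y != set0 -> f Y = f set0 ->
      exists X, separates f G X.
    move=> sY Y0 fY; exists Y; apply: separates_loop => //.
      by apply: subset_trans sY (subsetDl _ _).
    by apply: contraTneq Ge => <-; apply/negP => /(subsetP sY); rewrite setD11.
  have m1 := mono _ _ (sub0set X); have m2 := mono _ _ (sub0set (G :\ e :\: X)).
  have [fX|fX] := eqVneq (f X) (f set0); first exact: (loop X).
  apply: (loop (G :\ e :\: X)); [exact: subsetDl| |by lia].
  by rewrite setD_eq0; apply: contra XG => sGX; rewrite eqEsubset sX.
have [P sepP] := IHm _ _ ltG'm (contract_rank_function e f_rank) ne1 crapo2.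
exact: (separates_minors f_rank Ge eqG sepX sepP).
Qed.
End Crapo.

(** * Rank and closure in a matroid *)

(* Coercions leave convertible variants of [{set 'I_n}] that [lia] keeps apart. *)
Ltac slia := unfold reverse_coercion in *; lia.

Section MatroidRank.
Variables (n : nat) (M : matroid n).
Implicit Types (A B I S X Y : {set 'I_n}) (i : 'I_n).
Local Notation r := (rank M).

Lemma rank_geP I X : I \in indep M -> I \subset X -> (#|I| <= r X)%N.
Proof. by move=> indI sIX; apply: (leq_bigmax_cond (F := fun I => #|I|)); rewrite indI. Qed.

(** By exchange, an independent set maximal in [X] among those containing [I] has maximum size. *)
Lemma indep_basis I X : I \in indep M -> I \subset X ->
  exists B, [/\ B \in indep M, I \subset B, B \subset X & #|B| = r X].
Proof.
move=> indI sIX; pose p B := (B \in indep M) && (B \subset X).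
have [B /maxsetP[/andP[indB sBX] maxB] sIB] : {B | maxset p B & I \subset B}.
  by apply: maxset_exists; rewrite /p indI.
exists B; split=> //; apply/eqP; rewrite eqn_leq rank_geP //=.
apply/bigmax_leqP => C /andP[indC sCX]; rewrite leqNgt; apply/negP => ltBC.
have [i /setDP[Ci nBi] indBi] := indep_exchange indB indC ltBC.
have /setP/(_ i) : i |: B = B.
  by apply: maxB (subsetUr _ _); rewrite /p indBi subUset sub1set sBX (subsetP sCX).
by rewrite setU11 (negPf nBi).
Qed.

Lemma rank_basis X : exists B, [/\ B \in indep M, B \subset X & #|B| = r X].
Proof. by have [B [? _ ? ?]] := indep_basis (indep0 M) (sub0set X); exists B. Qed.

Lemma rank_le_card X : (r X <= #|X|)%N.
Proof. by have [B [_ sBX <-]] := rank_basis X; apply: subset_leq_card. Qed.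

Lemma indep_rank X : (X \in indep M) = (r X == #|X|).
Proof.
apply/idP/eqP => [indX|rX]; first by apply/eqP; rewrite eqn_leq rank_le_card rank_geP.
have [B [indB sBX cB]] := rank_basis X.
by have /eqP<- : B == X by rewrite eqEcard sBX cB rX /=.
Qed.

Lemma rank0 : r set0 = 0%N.
Proof. by apply/eqP; rewrite -leqn0 -(cards0 'I_n) rank_le_card. Qed.

Lemma rank_mono A B : A \subset B -> (r A <= r B)%N.
Proof.
by move=> sAB; have [I [indI sIA <-]] := rank_basis A; apply: rank_geP (subset_trans sIA sAB).
Qed.

(** A basis of [A :&: B] is extended to a basis [J] of [A :|: B], and [J] is counted inside [A] and
    inside [B]. *)
Lemma rank_submod A B : (r (A :|: B) + r (A :&: B) <= r A + r B)%N.
Proof.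
have [I [indI sI cI]] := rank_basis (A :&: B).
have [|J [indJ sIJ sJ <-]] := @indep_basis I (A :|: B) indI.
  by apply: subset_trans sI (subset_trans (subsetIl _ _) (subsetUl _ _)).
have leA : (#|J :&: A| <= r A)%N.
  by apply: rank_geP (subsetIr _ _); apply: indepS indJ; apply: subsetIl.
have leB : (#|J :&: B| <= r B)%N.
  by apply: rank_geP (subsetIr _ _); apply: indepS indJ; apply: subsetIl.
apply: leq_trans (leq_add leA leB); rewrite -cardsUI -setIUr (setIidPl sJ).
rewrite leq_add2l -cI subset_leq_card // setIACA setIid subsetI sIJ; exact: sI.
Qed.

Lemma rank_unit i A : (r (i |: A) <= (r A).+1)%N.
Proof.
have := rank_submod [set i] A; have := rank_le_card [set i]; rewrite cards1; slia.
Qed.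

Lemma rank_rank_function : rank_function r.
Proof. by split; [exact: rank_mono | exact: rank_submod | move=> i A; exact: rank_unit]. Qed.

Lemma beta_eq0_separates : loopless M -> (0 < n)%N -> beta M = 0 ->
  exists X, separates r [set: 'I_n] X.
Proof.
move=> noloop n_gt0 beta0; apply: (crapo_eq0_separates rank_rank_function).
  have := rank_mono (subsetT [set Ordinal n_gt0]); rewrite rank0.
  by have := noloop (Ordinal n_gt0); rewrite indep_rank cards1 => /eqP ->; rewrite lt0n.
rewrite -[RHS]beta0 /crapo /beta /crapo_sum rank0 addn0.
by congr (_ * _); apply: eq_bigl => S; rewrite subsetT.
Qed.

(** The rank is additive along [X]: submodularity for [S, X] and then for [S :|: X, ~: X] gives
    [r (S :&: X) + r (S :\: X) <= r S]. *)
Lemma separates_indep X S : separates r [set: 'I_n] X ->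
  S :&: X \in indep M -> S :\: X \in indep M -> S \in indep M.
Proof.
case/and4P=> _ _ _ /eqP; rewrite rank0 addn0 !indep_rank => sep /eqP r1 /eqP r2.
have := rank_submod S X; have := rank_submod (S :|: X) (~: X).
rewrite -setUA setUCr setUT setIUl setICr setU0 -setDE => s1 s2.
have := rank_le_card S; rewrite setTD in sep; rewrite -(cardsID X S) eqn_leq.
slia.
Qed.

Definition mclosure S := [set i | r (i |: S) == r S].

Lemma sub_mclosure S : S \subset mclosure S.
Proof. by apply/subsetP=> i Si; rewrite inE (setUidPr _) // sub1set. Qed.

(** Elements of the closure are added one at a time, submodularity keeping the rank of [S]; one more
    use of submodularity brings in [T]. *)
Lemma rankU_mclosure S T : r (mclosure S :|: T) = r (S :|: T).
Proof.
apply/eqP; rewrite eqn_leq andbC rank_mono ?setSU ?sub_mclosure //=.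
have rU X : X \subset mclosure S -> r (X :|: S) = r S.
  have [m] := ubnP #|X|; elim: m X => // m IHm X ltXm sX.
  have [->|/set0Pn[i Xi]] := eqVneq X set0; first by rewrite set0U.
  have sX' : X :\ i \subset mclosure S by apply: subset_trans (subsetDl _ _) sX.
  have IH : r (X :\ i :|: S) = r S by apply: IHm; rewrite // (cardsD1 i X) Xi in ltXm.
  have := rank_submod (i |: S) (X :\ i :|: S); rewrite setUACA setUid setD1K // IH.
  have /(subsetP sX) := Xi; rewrite inE => /eqP ->.
  have := rank_mono (subsetUr X S).
  have : S \subset (i |: S) :&: (X :\ i :|: S) by rewrite subsetI !subsetUr.
  by move/rank_mono; slia.
have := rank_submod (mclosure S :|: S) (S :|: T); rewrite rU //.
have : S \subset (mclosure S :|: S) :&: (S :|: T) by rewrite subsetI subsetUr subsetUl.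
have -> : mclosure S :|: S :|: (S :|: T) = mclosure S :|: T.
  by rewrite setUA -(setUA (mclosure S)) setUid (setUidPl (sub_mclosure S)).
by move/rank_mono; slia.
Qed.

Lemma rank_mclosure S : r (mclosure S) = r S.
Proof. by have := rankU_mclosure S set0; rewrite !setU0. Qed.

Lemma mclosureUl A B T : mclosure A = mclosure B -> mclosure (A :|: T) = mclosure (B :|: T).
Proof.
move=> clAB; apply/setP=> i; rewrite !inE ![i |: _]setUC -!setUA.
by rewrite -!(rankU_mclosure A) -!(rankU_mclosure B) clAB.
Qed.

Lemma mclosure_mclosure S : mclosure (mclosure S) = mclosure S.
Proof. by apply/setP=> i; rewrite !inE setUC rankU_mclosure setUC rank_mclosure. Qed.

Lemma mclosureS A B : A \subset B -> mclosure A \subset mclosure B.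
Proof.
move=> sAB; apply/subsetP=> i; rewrite !inE => /eqP eqA.
have := rank_submod (i |: A) B; rewrite -setUA (setUidPr sAB) eqA.
have : A \subset (i |: A) :&: B by rewrite subsetI subsetUr.
move/rank_mono; have := rank_mono (subsetUr [set i] B); slia.
Qed.

(** The rank of [S :\ i] is already [r S], so [i] lies in its closure. Hence the terms of a boundary
    with independent index all lie over one flat. *)
Lemma mclosure_dep_setD1 S i : S \notin indep M -> i \in S -> S :\ i \in indep M ->
  mclosure (S :\ i) = mclosure S.
Proof.
move=> depS Si indSi; have := rank_mono (subsetDl S [set i]).
move: depS indSi; rewrite !indep_rank (cardsD1 i S) Si => depS /eqP rSi le.
have := rank_le_card S; rewrite (cardsD1 i S) Si => le2.
apply/eqP; rewrite eqEsubset mclosureS ?subsetDl //=.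
rewrite -(mclosure_mclosure (S :\ i)); apply: mclosureS.
have : i |: (S :\ i) \subset mclosure (S :\ i); last by rewrite setD1K.
rewrite subUset sub_mclosure andbT sub1set inE setD1K //; slia.
Qed.
End MatroidRank.

(** * Interior products on the exterior algebra *)

Section InteriorProduct.
Variables (K : fieldType) (n : nat).
Local Notation E := (exterior K n).
Implicit Types (x y z : E) (A B S : {set 'I_n}) (i j : 'I_n) (c d : 'I_n -> K).
Local Notation e := (ext_gen K).
Local Notation eS := (ext_mon K).

(** For [i] in [S], [(-1) ^+ below i S] is the sign relating [e_i * e_(S :\ i)] to [e_S]. *)
Definition below i S := #|[set k in S | (k < i)%N]|.

Lemma extD x y S : (x + y) S = x S + y S. Proof. by rewrite ffunE. Qed.

Lemma extN x S : (- x) S = - x S. Proof. by rewrite ffunE. Qed.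

Lemma extZ (k : K) x S : (k *: x) S = k * (x S : K). Proof. by rewrite ffunE. Qed.

Lemma ext1 S : (1 : E) S = (S == set0)%:R.
Proof. by rewrite -[1 : E]/(ext_one K n) ffunE. Qed.

Lemma belowU1 i j S : j \notin S -> below i (j |: S) = ((j < i)%N + below i S)%N.
Proof.
move=> nSj; rewrite /below; have [lt_ji|ge_ji] := ltnP j i.
  have -> : [set k in j |: S | (k < i)%N] = j |: [set k in S | (k < i)%N].
    by apply/setP=> k; rewrite !inE; case: eqP => // ->; rewrite lt_ji.
  by rewrite cardsU1 !inE (negPf nSj).
apply: eq_card => k; rewrite !inE; case: eqP => // ->.
by rewrite (negPf nSj) ltnNge ge_ji.
Qed.

Lemma belowD1 i j S : j \in S -> below i S = ((j < i)%N + below i (S :\ j))%N.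
Proof. by move=> Sj; rewrite -{1}(setD1K Sj) belowU1 // setD11. Qed.

Lemma below_setU1 i S : below i (i |: S) = below i S.
Proof.
have [Si|nSi] := boolP (i \in S); last by rewrite belowU1 // ltnn.
by rewrite (setUidPr _) // sub1set.
Qed.

Lemma ext_genM i y S :
  (e i * y) S = if i \in S then (-1) ^+ below i S * (y (S :\ i) : K) else 0.
Proof.
rewrite -[e i * y]/(ext_mul _ _) ffunE; case: ifPn => [Si|nSi].
  rewrite (bigD1 [set i]) ?sub1set //= big1 => [|A /andP[_ /negPf nA]]; last first.
    by rewrite ffunE nA mulr0 mul0r.
  rewrite ffunE eqxx mulr1 addr0 /inversions big_set1 (belowD1 _ Si) ltnn.
  congr (_ ^+ _ * _); rewrite /below -sum1_card big_mkcond [RHS]big_mkcond /=.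
  by apply: eq_bigr => k _; rewrite !inE; do !case: ifP => //.
rewrite big1 // => A sAS; rewrite ffunE; case: eqP => [A1|_]; last by rewrite mulr0 mul0r.
by rewrite A1 sub1set (negPf nSi) in sAS.
Qed.

Lemma ext_monM A B : eS A * eS B =
  if [disjoint A & B] then (-1) ^+ inversions A B *: eS (A :|: B) else 0.
Proof.
apply/ffunP=> S; rewrite -[eS A * eS B]/(ext_mul _ _) ffunE !ext_monE.
have [sAS|nAS] := boolP (A \subset S); last first.
  rewrite big1 => [|C sCS]; last first.
    rewrite ffunE; case: eqP => [CA|]; first by rewrite -CA sCS in nAS.
    by rewrite mulr0 mul0r.
  case: ifP => _; rewrite !ffunE //.
  case: eqP => [SAB|_]; last by rewrite scaler0.
  by rewrite SAB subsetUl in nAS.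
rewrite (bigD1 A) //= big1 => [|C /andP[_ /negPf nC]]; last first.
  by rewrite ffunE nC mulr0 mul0r.
rewrite !ffunE eqxx mulr1 addr0; have [dAB|ndAB] := boolP [disjoint A & B].
  rewrite !ffunE; have -> : (S :\: A == B) = (S == A :|: B).
    apply/eqP/eqP => [<-|->]; first by rewrite -{1}(setIidPr sAS) setID.
    by rewrite setDUl setDv set0U; apply/setDidPl; rewrite disjoint_sym.
  case: eqP => [->|_]; last by rewrite mulr0 scaler0.
  rewrite setDUl setDv set0U (setDidPl _) //; by rewrite disjoint_sym.
rewrite ffunE; case: eqP => [SB|]; last by rewrite mulr0.
by case/negP: ndAB; rewrite -SB disjoint_sym disjoints_subset subsetDr.
Qed.

Lemma ext_sum_mon x : x = \sum_S (x S : K) *: eS S.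
Proof.
apply/ffunP=> S; rewrite sum_ffunE (bigD1 S) //= big1 => [|A nA].
  by rewrite ext_monE !ffunE eqxx addr0 /GRing.scale /= mulr1.
by rewrite ext_monE !ffunE eq_sym (negPf nA) scaler0.
Qed.

(** Monomials are products of generators and span [E], so a linear identity need only be checked at
    [1] and under left multiplication by generators. *)
Lemma ext_ind (P : E -> Prop) : P 1 -> (forall i x, P x -> P (e i * x)) ->
  (forall (k : K) x y, P x -> P y -> P (k *: x + y)) -> P 0 -> forall x, P x.
Proof.
move=> P1 PM PD P0 x; rewrite [x]ext_sum_mon; elim/big_ind: _ => // [y z Py Pz|S _].
  by rewrite -[y]scale1r; apply: PD.
rewrite -[X in P X]addr0; apply: PD => //; rewrite /ext_mon.
by elim: (enum S) => [|i s IHs]; rewrite ?big_nil // big_cons; apply: PM.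
Qed.

Definition intprod c x : E :=
  [ffun S : {set 'I_n} => \sum_(j | j \notin S) c j * (-1) ^+ below j S * (x (j |: S) : K)].

Lemma intprodE c x S : intprod c x S =
  \sum_(j | j \notin S) c j * (-1) ^+ below j S * (x (j |: S) : K).
Proof. by rewrite ffunE. Qed.

Lemma intprod_is_linear c : linear (intprod c).
Proof.
move=> k x y; apply/ffunP=> S; rewrite extD extZ !intprodE mulr_sumr -big_split /=.
by apply: eq_bigr => j _; rewrite extD extZ mulrDr mulrCA.
Qed.

HB.instance Definition _ c :=
  GRing.isLinear.Build K E E _ (intprod c) (intprod_is_linear c).

Lemma intprod1 c : intprod c 1 = 0.
Proof.
apply/ffunP=> S; rewrite intprodE big1 ?ffunE // => j _.
rewrite ext1; case: eqP => [/setP/(_ j)|_]; last by rewrite mulr0.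
by rewrite !inE eqxx.
Qed.

Lemma intprod_genM c i y : intprod c (e i * y) = c i *: y - e i * intprod c y.
Proof.
apply/ffunP=> S; rewrite extD extN extZ intprodE !ext_genM intprodE.
have [Si|nSi] := boolP (i \in S); last first.
  rewrite oppr0 addr0 (bigD1 i) //= big1 => [|j /andP[nSj ji]]; last first.
    by rewrite ext_genM !inE eq_sym (negPf ji) (negPf nSi) mulr0.
  rewrite ext_genM setU11 setU1K // below_setU1 addr0 -!mulrA signrMK.
  by [].
(* The term [j = i] cancels [c i *: y]; in the others, exchanging [i] and [j] costs one sign. *)
rewrite [X in _ - _ * X](bigD1 i) ?setD11 //= setD1K // mulrDr opprD.
have -> : below i S = below i (S :\ i) by rewrite (belowD1 _ Si) ltnn.
rewrite -mulrA mulrCA signrMK.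
rewrite addrA subrr add0r mulr_sumr -sumrN.
rewrite (eq_bigl (fun j => (j \notin S :\ i) && (j != i))) => [|j]; last first.
  by rewrite !inE; case: eqP => [->|]; rewrite ?Si ?andbT ?andbF.
apply: eq_bigr => j /andP[nSj ji]; rewrite ext_genM.
have nSj' : j \notin S by move: nSj; rewrite !inE ji.
rewrite inE Si orbT (belowD1 j Si) (belowU1 i nSj') (belowD1 i Si) ltnn.
have -> : (j |: S) :\ i = j |: S :\ i.
  by apply/setP=> k; rewrite !inE; case: eqP => // ->; rewrite eq_sym (negPf ji).
have [lt_ij|lt_ji|/val_inj eq_ij] := ltngtP i j; last by rewrite eq_ij eqxx in ji.
- by rewrite add0n add1n exprS; ring.
- by rewrite !add0n !add1n exprS; ring.
Qed.

(** The parity involution of [E], which supplies the sign in the graded Leibniz rule for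
    [intprod]. *)
Definition hat x : E := [ffun S : {set 'I_n} => (-1) ^+ #|S| * (x S : K)].

Lemma hatE x S : hat x S = (-1) ^+ #|S| * (x S : K). Proof. by rewrite ffunE. Qed.

Lemma hat_is_linear : linear hat.
Proof.
by move=> k x y; apply/ffunP=> S; rewrite extD extZ !hatE extD extZ mulrDr mulrCA.
Qed.

HB.instance Definition _ := GRing.isLinear.Build K E E _ hat hat_is_linear.

Lemma hat1 : hat 1 = 1.
Proof.
apply/ffunP=> S; rewrite hatE ext1.
by case: eqP => [->|]; rewrite ?mulr0 // cards0 mulr1.
Qed.

Lemma hat_genM i x : hat (e i * x) = - (e i * hat x).
Proof.
apply/ffunP=> S; rewrite extN hatE !ext_genM; case: ifP => Si; last by rewrite mulr0 oppr0.
by rewrite hatE (cardsD1 i S) Si exprS; ring.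
Qed.

Lemma hat_mon S : hat (eS S) = (-1) ^+ #|S| *: eS S.
Proof.
by apply/ffunP=> A; rewrite hatE extZ ext_monE ffunE; case: eqP => [->|_]; rewrite ?mulr0.
Qed.

Lemma intprodM c x y : intprod c (x * y) = intprod c x * y + hat x * intprod c y.
Proof.
elim/ext_ind: x => [|i x IHx|k x z IHx IHz|].
- by rewrite intprod1 hat1 mul0r add0r !mul1r.
- rewrite -mulrA !intprod_genM IHx hat_genM mulrBl mulrDr mulNr scalerAl !mulrA.
  by rewrite opprD addrA.
- rewrite mulrDl -scalerAl !linearP /= IHx IHz !mulrDl -!scalerAl scalerDr.
  by rewrite addrACA.
- by rewrite mul0r !linear0 !mul0r addr0.
Qed.

Lemma intprod_anticomm c d x : intprod c (intprod d x) = - intprod d (intprod c x).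
Proof.
elim/ext_ind: x => [|i x IHx|k x z IHx IHz|].
- by rewrite !intprod1 !linear0 ?oppr0.
- rewrite !(intprod_genM, linearB, linearZ) /= !intprod_genM IHx.
  by rewrite mulrN !opprK scalerN opprD addrCA.
- by rewrite !linearP /= IHx IHz ?scalerN ?opprD.
- by rewrite !linear0 ?oppr0.
Qed.

(** Anticommutation with itself gives only twice this identity, which is void in characteristic 2;
    hence a separate induction. *)
Lemma intprod_sq c x : intprod c (intprod c x) = 0.
Proof.
elim/ext_ind: x => [|i x IHx|k x z IHx IHz|].
- by rewrite intprod1 linear0.
- by rewrite intprod_genM linearB linearZ /= intprod_genM IHx mulr0 subr0 subrr.
- by rewrite !linearP /= IHx IHz scaler0 addr0.
- by rewrite !linear0.
Qed.

(** With all weights 1 the interior product is the boundary, so the rules for [intprod] apply to the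
    generators of [J]. *)
Lemma ext_bd_intprod S : ext_bd K S = intprod (fun=> 1) (eS S).
Proof.
apply/ffunP=> A; rewrite sum_ffunE intprodE.
rewrite [LHS](eq_bigr (fun i => (-1) ^+ below i S * (A == S :\ i)%:R)) => [|i _]; last first.
  by rewrite extZ ext_monE ffunE.
rewrite [LHS]big_mkcond [RHS]big_mkcond /=; apply: eq_bigr => i _.
rewrite ext_monE ffunE mul1r; have [Si|nSi] := boolP (i \in S).
  have [Ai|nAi] := boolP (i \in A) => /=.
    by case: eqP => [eqA|]; rewrite /= ?mulr0 //; move: Ai; rewrite eqA setD11.
  have -> : (A == S :\ i) = (i |: A == S).
    by apply/eqP/eqP => [->|<-]; rewrite ?setD1K ?setU1K.
  by case: eqP => [<-|_]; rewrite ?below_setU1 ?mulr0.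
by case: ifP => // _; case: eqP => [eqS|_]; rewrite /= ?mulr0 //; move: nSi; rewrite -eqS setU11.
Qed.

End InteriorProduct.

(** * The Orlik-Solomon ideal *)

Section IdealGen.
Variables (K : fieldType) (A : falgType K) (X : seq A).
Implicit Types (a b g x : A) (W : {vspace A}).

(** Preimages of [W] under multiplication maps are subspaces, so they may be tested on spanning
    elements of each factor. *)
Lemma ideal_gen_subv W : (forall a b g, g \in X -> a * g * b \in W) ->
  (ideal_gen X <= W)%VS.
Proof.
move=> XW; apply/prodvP => y b /[swap] _.
suff /subvP sub : (fullv * <<X>> <= amulr b @^-1: W)%VS.
  by move/sub; rewrite -memv_preim lfunE.
apply/prodvP => a g _; suff /subvP sub : (<<X>> <= (amulr b \o amull a) @^-1: W)%VS.
  by move/sub; rewrite -!memv_preim !lfunE /= !lfunE.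
by apply/span_subvP => h Xh; rewrite -memv_preim !lfunE /= !lfunE; apply: XW.
Qed.

Lemma mem_ideal_gen g : g \in X -> g \in ideal_gen X.
Proof.
move=> Xg; rewrite -[g]mulr1 -[g]mul1r.
by apply: memv_mul (memvf 1); apply: memv_mul (memvf 1) (memv_span Xg).
Qed.

Lemma ideal_genMr x b : x \in ideal_gen X -> x * b \in ideal_gen X.
Proof.
move=> xI; have /subvP : (ideal_gen X * fullv <= ideal_gen X)%VS.
  by rewrite /ideal_gen -!prodvA; apply: prodvSr; apply: prodvSr; apply: subvf.
by apply; apply: memv_mul xI (memvf b).
Qed.

End IdealGen.

Section OSIdeal.
Variables (K : fieldType) (n : nat) (M : matroid n).
Local Notation E := (exterior K n).
Implicit Types (x y z : E) (A B S X : {set 'I_n}) (i j : 'I_n) (c : 'I_n -> K).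
Local Notation e := (ext_gen K).
Local Notation eS := (ext_mon K).
Local Notation J := (OS_ideal K M).

Lemma ext_gen_sq i x : e i * (e i * x) = 0.
Proof.
apply/ffunP=> S; rewrite ext_genM; case: ifP => [Si|]; last by rewrite ffunE.
by rewrite ext_genM setD11 mulr0 ffunE.
Qed.

Lemma ext_gen_anticomm i j x : e i * (e j * x) = - (e j * (e i * x)).
Proof.
have [->|ij] := eqVneq i j; first by rewrite ext_gen_sq oppr0.
apply/ffunP=> S; rewrite extN !ext_genM !inE ij eq_sym ij /=.
have [Si|nSi] := boolP (i \in S); last by rewrite mulr0 if_same oppr0.
have [Sj|nSj] := boolP (j \in S); last by rewrite mulr0 oppr0.
rewrite (belowD1 i Sj) (belowD1 j Si).
have -> : S :\ i :\ j = S :\ j :\ i by rewrite !setDDl setUC.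
have [lt_ij|lt_ji|/val_inj eq_ij] := ltngtP i j; last by rewrite eq_ij eqxx in ij.
- by rewrite add0n add1n exprS; ring.
- by rewrite !add0n !add1n exprS; ring.
Qed.

Lemma OS_idealMl a x : x \in J -> a * x \in J.
Proof. exact: ideal_genMl. Qed.

Lemma OS_idealMr x b : x \in J -> x * b \in J.
Proof. exact: ideal_genMr. Qed.

Lemma OS_ideal_bd S : S \notin indep M -> ext_bd K S \in J.
Proof.
move=> depS; apply: mem_ideal_gen; apply/imageP; exists S => //.
by rewrite inE.
Qed.

(** For [i] in [S], [e_i * e_S = 0]; applying the boundary antiderivation gives
    [e_S = e_i * ext_bd K S]. *)
Lemma OS_ideal_mon S : S \notin indep M -> eS S \in J.
Proof.
move=> depS; have /set0Pn[i Si] : S != set0.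
  by apply: contraNneq depS => ->; apply: indep0.
have eiS : e i * eS S = 0.
  apply/ffunP=> A; rewrite ext_genM ext_monE !ffunE; case: ifP => // Ai.
  by case: eqP => [eqS|_]; rewrite /= ?mulr0 //; move: Si; rewrite -eqS setD11.
have := intprod_genM (fun=> 1) i (eS S); rewrite eiS linear0 -ext_bd_intprod scale1r.
by move/eqP; rewrite eq_sym subr_eq0 => /eqP ->; apply/OS_idealMl/OS_ideal_bd.
Qed.

Lemma hat_bd S : hat (ext_bd K S) = (-1) ^+ #|S|.-1 *: ext_bd K S.
Proof.
rewrite /ext_bd linear_sum scaler_sumr; apply: eq_bigr => i Si /=.
by rewrite linearZ /= hat_mon (cardsD1 i S) Si add1n /= !scalerA mulrC.
Qed.

(** In the Leibniz expansion of [a * g * b], every term but the one with [intprod c g] keeps the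
    factor [g] up to sign, so the generators decide. *)
Lemma intprod_ideal c : (forall S, S \notin indep M -> intprod c (ext_bd K S) \in J) ->
  forall x, x \in J -> intprod c x \in J.
Proof.
move=> cbd x; suff /subvP sub : (J <= linfun (intprod c) @^-1: J)%VS.
  by move/sub; rewrite -memv_preim lfunE.
apply: ideal_gen_subv => a b g /imageP[S]; rewrite inE => depS ->.
rewrite -memv_preim lfunE /= -mulrA !intprodM hat_bd.
have Jbd := OS_ideal_bd depS; apply: memvD; apply: OS_idealMl; first exact: OS_idealMr.
by apply: memvD; apply: OS_idealMr; [apply: cbd | apply: memvZ].
Qed.

Lemma intprod1_ideal x : x \in J -> intprod (fun=> 1) x \in J.
Proof.
by apply: intprod_ideal => S _; rewrite ext_bd_intprod intprod_sq mem0v.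
Qed.

(** Anticommutation moves [d_c] onto [e_S], where it acts as the boundary on [S :&: X] and as zero
    on [S :\: X]. A dependent [S] has a dependent part inside or outside [X]; either way [d_c e_S]
    is in [J], which the boundary preserves. *)
Lemma intprod_sep_ideal X x : separates (rank M) [set: 'I_n] X ->
  x \in J -> intprod (fun i => (i \in X)%:R) x \in J.
Proof.
move=> sepX; set c := fun i => _; apply: intprod_ideal => S depS.
rewrite ext_bd_intprod intprod_anticomm rpredN; apply: intprod1_ideal.
have c_in A : A \subset X -> intprod c (eS A) = ext_bd K A.
  move=> sAX; rewrite ext_bd_intprod; apply/ffunP=> B; rewrite !intprodE.
  apply: eq_bigr => i _; rewrite ext_monE ffunE.
  case: eqP => [eqA|_]; last by rewrite !mulr0.
  by rewrite /c (subsetP sAX) // -eqA setU11.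
have c_out A : A :&: X = set0 -> intprod c (eS A) = 0.
  move=> AX; apply/ffunP=> B; rewrite intprodE big1 ?ffunE // => i _.
  rewrite ext_monE ffunE; case: eqP => [eqA|_]; last by rewrite mulr0.
  have /setP/(_ i) := AX; rewrite !inE -eqA setU11 /= /c => ->.
  by rewrite !mul0r.
have [k kS] : exists k : K, eS S = k *: (eS (S :&: X) * eS (S :\: X)).
  exists ((-1) ^+ inversions (S :&: X) (S :\: X)); rewrite ext_monM.
  have -> : [disjoint S :&: X & S :\: X].
    by rewrite -setI_eq0 setIDA setIAC -setIDA setDv setI0.
  by rewrite setID scalerA -exprD addnn -signr_odd odd_double expr0 scale1r.
rewrite kS linearZ memvZ //= intprodM c_in ?subsetIr // (c_out (S :\: X)); last first.
  by apply/setP=> i; rewrite !inE; case: (i \in X); rewrite // andbF.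
rewrite mulr0 addr0; have [ind|dep] := boolP (S :&: X \in indep M); last first.
  by apply: OS_idealMr; apply: OS_ideal_bd.
apply/OS_idealMl/OS_ideal_mon; apply: contra depS => ind2.
exact: separates_indep sepX ind ind2.
Qed.

(* The derivation [intprod c] provides a contracting homotopy for [e i]. *)
Lemma ext_gen_regular (L : {vspace E}) c i : c i = 1 ->
  (forall x, x \in L -> intprod c x \in L) -> (forall x, x \in L -> e i * x \in L) ->
  forall x, (e i * x \in L) = (x \in L + limg (amull (e i)))%VS.
Proof.
move=> ci1 cL eL x; apply/idP/memv_addP => [Lx|[u Lu [v /memv_imgP[y _ ->] ->]]].
  exists (x - e i * intprod c x).
    by have := cL _ Lx; rewrite intprod_genM ci1 scale1r.
  exists (e i * intprod c x); last by rewrite subrK.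
  by apply/memv_imgP; exists (intprod c x); rewrite ?memvf // lfunE.
by rewrite lfunE /= mulrDr ext_gen_sq addr0; apply: eL.
Qed.

End OSIdeal.

(** * Gradings and supports *)

Section Support.
Variables (K : fieldType) (n : nat).
Local Notation E := (exterior K n).
Implicit Types (x y z : E) (A B S X : {set 'I_n}) (P Q : pred {set 'I_n}) (L : {vspace E}).
Local Notation e := (ext_gen K).
Local Notation eS := (ext_mon K).

Definition restr P x : E := [ffun S => if P S then x S else 0].

Lemma restrE P x S : restr P x S = if P S then x S else 0.
Proof. by rewrite ffunE. Qed.

Lemma restr_is_linear P : linear (restr P).
Proof.
move=> k x y; apply/ffunP=> S; rewrite extD extZ !restrE extD extZ.
by case: ifP; rewrite // mulr0 addr0.
Qed.

HB.instance Definition _ P := GRing.isLinear.Build K E E _ (restr P) (restr_is_linear P).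

Definition supp P : {vspace E} := limg (linfun (restr P)).

Lemma suppP P x : reflect (forall S, ~~ P S -> x S = 0) (x \in supp P).
Proof.
apply: (iffP memv_imgP) => [[y _ ->] S nPS|xP].
  by rewrite lfunE /= restrE (negPf nPS).
exists x; rewrite ?memvf // lfunE; apply/ffunP=> S /=; rewrite restrE.
by case: ifPn => // /xP.
Qed.

Lemma restr_supp P x : restr P x \in supp P.
Proof. by apply/suppP => S nPS; rewrite restrE (negPf nPS). Qed.

Lemma restr_id P x : x \in supp P -> restr P x = x.
Proof.
by move/suppP=> xP; apply/ffunP=> S; rewrite restrE; case: ifPn => // /xP.
Qed.

Lemma eq_supp P Q : P =1 Q -> supp P = supp Q.
Proof.
move=> PQ; apply/vspaceP => x; apply/suppP/suppP => xP S; have := xP S.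
  by rewrite PQ.
by rewrite -PQ.
Qed.

Lemma supp_pred0 P : P =1 xpred0 -> supp P = 0%VS.
Proof.
move=> P0; apply/eqP; rewrite -subv0; apply/subvP => x /suppP xP; rewrite memv0.
by apply/eqP/ffunP => S; rewrite xP ?ffunE // P0.
Qed.

Lemma restr_mon P S : restr P (eS S) = if P S then eS S else 0.
Proof.
apply/ffunP=> A; rewrite restrE ext_monE ffunE; case: eqP => [->|/eqP nAS].
  by case: ifP; rewrite ?ext_monE ffunE ?eqxx.
by rewrite if_same; case: ifP; rewrite ?ext_monE ffunE ?(negPf nAS).
Qed.

Definition graded (T : eqType) (f : {set 'I_n} -> T) L :=
  forall t x, x \in L -> restr (fun S => f S == t) x \in L.

Lemma graded_full (T : eqType) (f : {set 'I_n} -> T) : graded f fullv.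
Proof. by move=> t x _; apply: memvf. Qed.

Lemma dim_graded (T : finType) (f : {set 'I_n} -> T) L P : graded f L ->
  \dim (L :&: supp P) = (\sum_t \dim (L :&: supp (fun S => P S && (f S == t))))%N.
Proof.
move=> gr; pose U t := (L :&: supp (fun S => P S && (f S == t)))%VS.
have -> : (L :&: supp P = \sum_t U t)%VS.
  apply/eqP; rewrite eqEsubv; apply/andP; split; apply/subvP => x.
    rewrite memv_cap => /andP[Lx /suppP Px].
    have -> : x = \sum_t restr (fun S => f S == t) x.
      apply/ffunP => S; rewrite sum_ffunE (bigD1 (f S)) //= big1 => [|t nt].
        by rewrite restrE eqxx addr0.
      by rewrite restrE eq_sym (negPf nt).
    apply: memv_sumr => t _; rewrite memv_cap gr //=; apply/suppP => S.
    by rewrite negb_and restrE => /orP[/Px ->|/negPf ->]; rewrite ?if_same.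
  move=> /memv_sumP[u Uu ->]; apply: memv_suml => t _.
  have := Uu t isT; rewrite !memv_cap => /andP[-> /suppP uP] /=.
  by apply/suppP => S nPS; rewrite uP // negb_and nPS.
apply/directvP/directv_sum_independent => u Uu u0 t _.
have : restr (fun S => f S == t) (\sum_t u t) = 0 by rewrite u0 linear0.
rewrite linear_sum (bigD1 t) //= big1 => [|s nst].
  rewrite addr0 => <-; apply/ffunP => S; rewrite restrE; case: ifPn => // nft.
  have := Uu t isT; rewrite memv_cap => /andP[_ /suppP ->] //.
  by rewrite negb_and nft orbT.
apply/ffunP => S; rewrite restrE ffunE; case: ifP => // /eqP ft.
have := Uu s isT; rewrite memv_cap => /andP[_ /suppP ->] //.
by rewrite ft negb_and orbC eq_sym nst.
Qed.

Lemma dim_supp P : \dim (supp P) = #|P|.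
Proof.
rewrite -[supp P]capfv (dim_graded P (@graded_full _ id)) -sum1_card.
rewrite [RHS]big_mkcond; apply: eq_bigr => S _; rewrite capfv.
rewrite -topredE /=; case: ifPn => PS; last first.
  rewrite supp_pred0 ?dimv0 // => A; case: eqP => [->|_]; last exact: andbF.
  by rewrite (negPf PS).
suff -> : supp (fun A => P A && (A == S)) = <[eS S]>%VS.
  rewrite dim_vline; case: eqP => // /ffunP/(_ S).
  by rewrite ext_monE !ffunE eqxx => /eqP; rewrite oner_eq0.
apply/vspaceP => x; apply/suppP/vlineP => [xS|[k ->] A].
  exists (x S); apply/ffunP => A; rewrite extZ ext_monE ffunE.
  have [->|nAS] := eqVneq A S; first by rewrite mulr1.
  by rewrite mulr0 xS // (negPf nAS) andbF.
rewrite extZ ext_monE ffunE; case: eqP => [->|]; last by rewrite mulr0.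
by rewrite PS.
Qed.

Definition homog (d : nat) : pred {set 'I_n} := fun S => #|S| == d.

(** The Hilbert function of [E/L] when [L] is graded; integer values avoid truncated subtraction. *)
Definition quot_dim L (d : nat) : int :=
  (\dim (supp (homog d)))%:Z - (\dim (L :&: supp (homog d)))%:Z.

(* [intprod 1 + e i] is an involution exchanging the two parities. *)
Lemma dim_parity L X i : i \in X ->
  (forall x, x \in L -> intprod (fun=> 1) x \in L) -> (forall x, x \in L -> e i * x \in L) ->
  \dim (L :&: supp (fun S => (S \subset X) && ~~ odd #|S|)) =
  \dim (L :&: supp (fun S => (S \subset X) && odd #|S|)).
Proof.
move=> Xi dL eL; pose V b := (L :&: supp (fun S => (S \subset X) && (odd #|S| == b)))%VS.
suff le b : (\dim (V b) <= \dim (V (~~ b)))%N.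
  have := le true; have := le false; rewrite /V /= => le1 le2.
  rewrite (@eq_supp _ (fun S => (S \subset X) && (odd #|S| == false))); last first.
    by move=> S; rewrite eqbF_neg.
  rewrite [X in _ = \dim (_ :&: X)](@eq_supp _ (fun S => (S \subset X) && (odd #|S| == true))).
    by apply/eqP; rewrite eqn_leq le1.
  by move=> S; rewrite eqb_id.
pose phi : 'End(E) := (linfun (intprod (fun=> 1)) + amull (e i))%VF.
have phiE x : phi x = intprod (fun=> 1) x + e i * x by rewrite add_lfunE !lfunE.
(* Both summands square to zero, and their anticommutator is the weight of [i], which is 1. *)
have phiK x : phi (phi x) = x.
  by rewrite !phiE linearD /= intprod_sq intprod_genM mulrDr ext_gen_sq scale1r add0r addr0 subrK.
have ker0 : lker phi == 0%VS.
  by apply/lker0P => x y eqxy; rewrite -[x]phiK eqxy phiK.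
rewrite -(limg_dim_eq (f := phi)); last by rewrite (eqP ker0) capv0.
apply: dimvS; apply/subvP => _ /memv_imgP[x /[!memv_cap] /andP[Lx /suppP Px] ->].
rewrite phiE memvD ?dL ?eL //=; apply/suppP => S nPS; rewrite extD intprodE ext_genM.
rewrite big1 ?add0r => [|j nSj].
  case: ifP => // Si; rewrite Px ?mulr0 //; apply: contra nPS.
  rewrite (cardsD1 i S) Si addSn add0n /= => /andP[sSX /eqP <-].
  by rewrite eqxx andbT -(setD1K Si) subUset sub1set Xi.
rewrite Px ?mulr0 //; apply: contra nPS; rewrite cardsU1 nSj /=.
by move=> /andP[/(subset_trans (subsetUr _ _)) -> /eqP <-]; rewrite negbK eqxx.
Qed.

End Support.

(** * The grading of the Orlik-Solomon ideal by flats *)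

Section OSGrading.
Variables (K : fieldType) (n : nat) (M : matroid n).
Local Notation E := (exterior K n).
Implicit Types (x y z : E) (A B S X Y : {set 'I_n}).
Local Notation e := (ext_gen K).
Local Notation eS := (ext_mon K).
Local Notation J := (OS_ideal K M).
Local Notation r := (rank M).

(** Sizes are recorded in ['I_n.+1] so that the grades form a finite type, over which dimensions can
    be summed. *)
Definition grade S : {set 'I_n} * 'I_n.+1 := (mclosure M S, inord #|S|).

Lemma card_lt S : (#|S| < n.+1)%N.
Proof. by rewrite ltnS -[X in (_ <= X)%N]card_ord max_card. Qed.

Lemma grade_eq S Y (d : 'I_n.+1) :
  (grade S == (Y, d)) = (mclosure M S == Y) && (#|S| == d).
Proof. by rewrite xpair_eqE; congr (_ && _); rewrite -val_eqE /= inordK // card_lt. Qed.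

Lemma restr_mon3 P A B S :
  restr P (eS A * eS S * eS B) = if P (A :|: S :|: B) then eS A * eS S * eS B else 0.
Proof.
rewrite ext_monM; case: [disjoint A & S]; last by rewrite mul0r linear0 if_same.
rewrite -scalerAl ext_monM; case: [disjoint _ & B]; last by rewrite scaler0 linear0 if_same.
by rewrite !linearZ /= restr_mon; case: (P _); rewrite ?scaler0 // !scalerA mulrC.
Qed.

Lemma mon3_card A B S : eS A * eS S * eS B = 0 \/ #|A :|: S :|: B| = (#|A| + #|S| + #|B|)%N.
Proof.
rewrite ext_monM; case: ifP => dAS; last by left; rewrite mul0r.
rewrite -scalerAl ext_monM; case: ifP => dASB; last by left; rewrite scaler0.
by right; rewrite !cardsU (disjoint_setI0 dASB) (disjoint_setI0 dAS) cards0 !subn0.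
Qed.

(** Terms of a boundary with dependent [S :\ i] are themselves in [J]. The others share the closure
    of [S] and the size [#|S|.-1], so monomial multiples of their sum are homogeneous elements of
    [J]. *)
Lemma OS_graded : graded grade J.
Proof.
move=> t x; suff /subvP sub : (J <= linfun (restr (fun S => grade S == t)) @^-1: J)%VS.
  by move/sub; rewrite -memv_preim lfunE.
apply: ideal_gen_subv => a b g /imageP[S]; rewrite inE => depS ->.
rewrite -memv_preim lfunE /= [a]ext_sum_mon [b]ext_sum_mon.
rewrite !mulr_suml linear_sum; apply: memv_suml => A _.
rewrite mulr_sumr linear_sum; apply: memv_suml => B _.
rewrite -!scalerAl -scalerAr !linearZ /=; do 2!apply: memvZ.
set P := fun S => _.
pose s i : K := (-1) ^+ below i S.
pose hI := \sum_(i in S | S :\ i \in indep M) s i *: eS (S :\ i).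
pose hD := \sum_(i in S | S :\ i \notin indep M) s i *: eS (S :\ i).
have bdE : ext_bd K S = hI + hD by rewrite /ext_bd (bigID (fun i => S :\ i \in indep M)).
have JD : hD \in J.
  by apply: memv_suml => i /andP[_ dep]; apply: memvZ; apply: OS_ideal_mon.
have JI : hI \in J.
  by have := OS_ideal_bd K depS; rewrite bdE => Jbd; rewrite -[hI](addrK hD) memvB.
rewrite bdE mulrDr mulrDl linearD /=; apply: memvD; last first.
  rewrite mulr_sumr mulr_suml linear_sum; apply: memv_suml => i /andP[_ dep] /=.
  rewrite -scalerAr -scalerAl linearZ memvZ //= restr_mon3; case: ifP => _; last exact: mem0v.
  by apply: OS_idealMr; apply: OS_idealMl; apply: OS_ideal_mon.
(* The grade of every nonzero product [eS A * eS (S :\ i) * eS B] with [i] in [S] and [S :\ i]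
   independent. *)
pose t0 := (mclosure M (A :|: S :|: B), inord (#|A| + #|S|.-1 + #|B|) : 'I_n.+1).
suff -> : restr P (eS A * hI * eS B) = if t0 == t then eS A * hI * eS B else 0.
  by case: ifP => _; [apply: OS_idealMr; apply: OS_idealMl | apply: mem0v].
rewrite mulr_sumr mulr_suml linear_sum /=.
suff H i : (i \in S) && (S :\ i \in indep M) ->
    restr P (eS A * (s i *: eS (S :\ i)) * eS B) =
    if t0 == t then eS A * (s i *: eS (S :\ i)) * eS B else 0.
  by rewrite (eq_bigr _ H); case: ifP => // _; rewrite big1.
case/andP=> Si indSi; rewrite -scalerAr -scalerAl linearZ /= restr_mon3.
have [->|cardASB] := mon3_card A B (S :\ i); first by rewrite scaler0 !if_same scaler0.
suff -> : P (A :|: S :\ i :|: B) = (t0 == t) by case: ifP; rewrite ?scaler0.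
rewrite /P /t0 /grade cardASB; congr ((_, _) == _).
  rewrite -!setUA !(setUC A) -!setUA; apply: mclosureUl.
  exact: mclosure_dep_setD1.
by rewrite (cardsD1 i S) Si.
Qed.

Lemma OS_graded_card (d : nat) x :
  x \in J -> restr (homog d) x \in J.
Proof.
move=> Jx; have [le_dn|lt_nd] := ltnP d n.+1; last first.
  have -> : restr (homog d) x = 0; last exact: mem0v.
  apply/ffunP => S; rewrite restrE ffunE /homog; case: eqP => // cS.
  by have := card_lt S; rewrite cS ltnNge lt_nd.
have -> : restr (homog d) x =
    \sum_Y restr (fun S => grade S == (Y, Ordinal le_dn)) x.
  apply/ffunP => S; rewrite sum_ffunE (bigD1 (mclosure M S)) //= big1 => [|Y nY].
    by rewrite addr0 !restrE grade_eq eqxx.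
  by rewrite restrE grade_eq eq_sym (negPf nY).
by apply: memv_suml => Y _; apply: OS_graded.
Qed.

Lemma ext_mul_set0 x y : (x * y) set0 = (x set0 : K) * (y set0 : K).
Proof.
rewrite -[x * y]/(ext_mul _ _) ffunE (big_pred1 set0) => [|A]; last by rewrite /= subset0.
by rewrite setD0 inversions0l expr0 mul1r.
Qed.

(** Constant terms multiply, and only the boundary of a singleton has a nonzero one; singletons are
    independent here. *)
Lemma OS_ideal_set0 x : loopless M -> x \in J -> x set0 = 0.
Proof.
move=> noloop; suff /subvP sub : (J <= supp K (predC1 set0))%VS.
  by move/sub => /suppP -> //=; rewrite negbK.
apply: ideal_gen_subv => a b g /imageP[S]; rewrite inE => depS ->.
apply/suppP => _ /negPn/eqP ->; rewrite !ext_mul_set0.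
suff -> : ext_bd K S set0 = 0 by rewrite mulr0 mul0r.
rewrite ext_bd_intprod intprodE big1 // => j _; rewrite ext_monE ffunE.
case: eqP => [eqS|_]; last by rewrite mulr0.
by move: depS; rewrite -eqS setU0 noloop.
Qed.

Section Loopless.
Hypothesis noloop : loopless M.

Definition flat_dim Y (d : 'I_n.+1) := \dim (J :&: supp K (fun S => grade S == (Y, d))).

(** The Euler characteristic of the part of [J] over the flat [Y]. *)
Definition flat_sdim Y : int := \sum_(d < n.+1) (-1) ^+ d * (flat_dim Y d)%:Z.

(** A set lies below the flat [X] exactly when its closure does, so the part of [J] supported below
    [X] splits over the flats inside [X]; [dim_parity] balances the whole. *)
Lemma sum_flat_sdim X : X != set0 -> mclosure M X = X ->
  \sum_(Y : {set 'I_n} | Y \subset X) flat_sdim Y = 0.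
Proof.
move=> /set0Pn[i Xi] clX.
have eL x : x \in J -> ext_gen K i * x \in J by apply: OS_idealMl.
have := dim_parity Xi (@intprod1_ideal K n M) eL.
have clSX S : (S \subset X) = (mclosure M S \subset X).
  apply/idP/idP => [sSX|]; last by apply: subset_trans (sub_mclosure _ _).
  by rewrite -clX; apply: mclosureS.
have dimE (b : pred nat) : (\dim (J :&: supp K (fun S => (S \subset X) && b #|S|)))%:Z =
    \sum_(Y : {set 'I_n} | Y \subset X) \sum_(d < n.+1 | b d) (flat_dim Y d)%:Z :> int.
  rewrite (dim_graded _ OS_graded) (big_morph Posz PoszD erefl) pair_big_dep.
  rewrite [RHS]big_mkcond /=; apply: eq_bigr => -[Y d] _ /=.
  case: ifP => [/andP[sYX bd]|nYd]; rewrite /flat_dim.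
    congr (\dim (_ :&: _))%:Z; apply: eq_supp => S; rewrite clSX grade_eq.
    by apply/andP/idP => [[]//|/[dup] /andP[/eqP-> /eqP->] ->]; rewrite sYX bd.
  rewrite supp_pred0 ?capv0 ?dimv0 // => S; rewrite clSX grade_eq.
  by apply/negP => /andP[/[swap] /andP[/eqP-> /eqP->]]; rewrite nYd.
move=> eq_dim; rewrite (eq_bigr (fun Y => \sum_(d < n.+1 | ~~ odd d) (flat_dim Y d)%:Z
    - \sum_(d < n.+1 | odd d) (flat_dim Y d)%:Z)) => [|Y _].
  by rewrite sumrB -(dimE (fun d => ~~ odd d)) -(dimE odd) eq_dim subrr.
rewrite /flat_sdim (bigID (fun d : 'I_n.+1 => ~~ odd d)) /= -sumrN.
congr (_ + _).
  by apply: eq_bigr => d od; rewrite -signr_odd (negPf od) mul1r.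
by apply: eq_big => [d|d od]; rewrite ?negbK // -signr_odd (negPn od) mulN1r.
Qed.

(** Induction on size: in the sum over subsets of a nonempty flat, only the top term is left.
    Nothing lies over a set that is not a flat, and over the empty flat there is only the constant
    coordinate, which vanishes on [J]. *)
Lemma flat_sdim0 Y : flat_sdim Y = 0.
Proof.
have [m] := ubnP #|Y|; elim: m Y => // m IHm X ltXm.
have [clX|nclX] := eqVneq (mclosure M X) X; last first.
  rewrite /flat_sdim big1 // => d _; rewrite /flat_dim supp_pred0 ?capv0 ?dimv0 ?mulr0 // => S.
  rewrite grade_eq; case: eqP => //= eqX; case/eqP: nclX.
  by rewrite -eqX mclosure_mclosure.
have [X0|X0] := eqVneq X set0.
  rewrite /flat_sdim big1 // => d _; rewrite /flat_dim.
  suff -> : (J :&: supp K (fun S => grade S == (X, d)) = 0)%VS by rewrite dimv0 mulr0.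
  apply/eqP; rewrite -subv0; apply/subvP => x; rewrite memv_cap => /andP[Jx /suppP xP].
  rewrite memv0; apply/eqP/ffunP => S; rewrite ffunE.
  have [->|S0] := eqVneq S set0; first exact: OS_ideal_set0.
  apply: xP; rewrite grade_eq X0; apply: contra S0 => /andP[/eqP clS _].
  by rewrite -subset0 -clS sub_mclosure.
have := sum_flat_sdim X0 clX; rewrite (bigD1 X) //= big1 ?addr0 // => Y /andP[sYX nYX].
apply: IHm; move: ltXm; rewrite ltnS; apply: leq_trans.
by apply: proper_card; rewrite properEneq nYX.
Qed.

Lemma dim_flats (L : {vspace E}) (d : 'I_n.+1) : graded grade L ->
  \dim (L :&: supp K (homog d)) =
  (\sum_Y \dim (L :&: supp K (fun S => grade S == (Y, d))))%N.
Proof.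
move=> gr; rewrite (dim_graded _ gr).
rewrite -(pair_bigA _ (fun Y d' =>
  \dim (L :&: supp K (fun S => (#|S| == d) && (grade S == (Y, d')))))) /=.
apply: eq_bigr => Y _; rewrite (bigD1 d) //= big1 => [|d' nd']; last first.
  rewrite supp_pred0 ?capv0 ?dimv0 // => S; rewrite /homog grade_eq.
  apply/negP => /andP[/eqP-> /andP[_ /eqP/val_inj eq_d]].
  by rewrite eq_d eqxx in nd'.
rewrite addn0; congr (\dim (_ :&: _)); apply: eq_supp => S; rewrite /homog grade_eq.
by case: (#|S| == d); rewrite ?andbF ?andbT.
Qed.

(** A set with closure [Y] and size other than [r Y] is dependent, so its monomial lies in [J]. *)
Lemma flat_dim_rank Y (d : 'I_n.+1) : d != r Y :> nat ->
  flat_dim Y d = \dim (supp K (fun S => grade S == (Y, d))).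
Proof.
move=> ndY; rewrite /flat_dim (capv_idPr _) //; apply/subvP => x /suppP xP.
rewrite [x]ext_sum_mon; apply: memv_suml => S _.
have [gS|/xP ->] := boolP (grade S == (Y, d)); last by rewrite scale0r mem0v.
apply: memvZ; apply: OS_ideal_mon; rewrite indep_rank -(rank_mclosure M S).
by move: gS; rewrite grade_eq => /andP[/eqP-> /eqP->]; rewrite eq_sym.
Qed.

(** The right side is [- H'(-1)] for the Hilbert series [H] of [E/J]. Over a flat [Y] the quotient
    lives in degree [r Y], where the weights [r Y] and [d] agree. *)
Lemma crapo_quot_dim :
  \sum_(S : {set 'I_n}) (-1) ^+ #|S| * (r S)%:Z = \sum_(d < n.+1) (-1) ^+ d * d%:Z * quot_dim J d.
Proof.
pose N Y d := (\dim (supp K (fun S => grade S == (Y, d))))%:Z : int.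
transitivity (\sum_Y \sum_(d < n.+1) (-1) ^+ d * (r Y)%:Z * N Y d).
  rewrite pair_bigA (partition_big grade xpredT) //=; apply: eq_bigr => -[Y d] _ /=.
  rewrite /N dim_supp -sum1_card (big_morph Posz PoszD erefl) mulr_sumr.
  apply: eq_big => // S; rewrite grade_eq => /andP[/eqP <- /eqP ->].
  by rewrite rank_mclosure mulr1.
(* The part of [J] subtracted over [Y] contributes [r Y] times [flat_sdim Y], which is zero. *)
transitivity (\sum_Y \sum_(d < n.+1) (-1) ^+ d * (r Y)%:Z * (N Y d - (flat_dim Y d)%:Z)).
  apply: eq_bigr => Y _; transitivity
    (\sum_(d < n.+1) (-1) ^+ d * (r Y)%:Z * N Y d - (r Y)%:Z * flat_sdim Y).
    by rewrite flat_sdim0 mulr0 subr0.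
  rewrite /flat_sdim mulr_sumr -sumrB; apply: eq_bigr => d _.
  by rewrite mulrBr; congr (_ - _); rewrite mulrCA mulrA.
rewrite exchange_big; apply: eq_bigr => d _; rewrite /quot_dim.
have := dim_flats d OS_graded; have := dim_flats d (@graded_full K n _ grade).
rewrite capfv => -> ->; rewrite !(big_morph Posz PoszD erefl) -sumrB mulr_sumr.
apply: eq_bigr => Y _; rewrite capfv -/(N Y d) -/(flat_dim Y d).
have [->//|ndY] := eqVneq (d : nat) (r Y).
by rewrite (flat_dim_rank ndY) subrr !mulr0.
Qed.
End Loopless.
End OSGrading.

(** * Hilbert functions and regular elements *)

Section Hilbert.
Variables (K : fieldType) (n : nat).
Local Notation E := (exterior K n).
Implicit Types (v x : E) (S : {set 'I_n}) (L : {vspace E}).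

Definition card_graded L := forall (d : nat) x, x \in L -> restr (homog d) x \in L.

Definition regular_mod L v := forall x, (v * x \in L) = (x \in L + limg (amull v))%VS.

Lemma ext_deg1_sum v : ext_deg1 v -> v = \sum_i (v [set i] : K) *: ext_gen K i.
Proof.
move=> v1; apply/ffunP => S; rewrite sum_ffunE.
have [/cards1P[i ->]|nS] := boolP (#|S| == 1%N).
  rewrite (bigD1 i) //= big1 => [|j nji].
    by rewrite extZ !ffunE eqxx mulr1 addr0.
  by rewrite extZ ffunE (inj_eq set1_inj) eq_sym (negPf nji) mulr0.
rewrite big1 => [|i _].
  by apply/eqP; apply: contraNT nS => /v1 ->.
rewrite extZ ffunE; case: eqP => [S1|_]; last by rewrite mulr0.
by rewrite S1 cards1 in nS.
Qed.

Lemma restr_deg1M v d x : ext_deg1 v ->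
  restr (homog d.+1) (v * x) = v * restr (homog d) x.
Proof.
move/ext_deg1_sum => ->; rewrite !mulr_suml linear_sum; apply: eq_bigr => i _ /=.
rewrite -!scalerAl linearZ /=; congr (_ *: _).
apply/ffunP => S; rewrite restrE !ext_genM restrE /homog; case: (boolP (i \in S)) => Si.
  by rewrite (cardsD1 i S) Si add1n eqSS; case: ifP; rewrite ?mulr0.
by rewrite if_same.
Qed.

Lemma restr0_deg1M v x : ext_deg1 v -> restr (homog 0) (v * x) = 0.
Proof.
move/ext_deg1_sum => ->; rewrite !mulr_suml linear_sum big1 // => i _ /=.
rewrite -scalerAl linearZ /=; apply/ffunP => S; rewrite extZ restrE ext_genM /homog ffunE.
case: eqP => [/eqP|_]; last by rewrite mulr0.
by rewrite cards_eq0 => /eqP ->; rewrite inE mulr0.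
Qed.

Lemma quot_dim_gt L d : (n < d)%N -> quot_dim L d = 0.
Proof.
move=> lt_nd; rewrite /quot_dim supp_pred0 ?capv0 ?dimv0 // => S.
by apply/negbTE; apply: contraTneq lt_nd => <-; rewrite -leqNgt -[X in (_ <= X)%N]card_ord max_card.
Qed.

Section RegularElement.
Variables (L : {vspace E}) (v : E).
Hypotheses (L_graded : card_graded L) (v_deg1 : ext_deg1 v) (v_reg : regular_mod L v).
Local Notation L' := (L + limg (amull v))%VS.

Lemma regular_mod_graded : card_graded L'.
Proof.
move=> d x /memv_addP[u Lu [w /memv_imgP[y _ ->] ->]]; rewrite linearD /=.
apply: memv_add; first exact: L_graded.
rewrite lfunE /=; case: d => [|d]; first by rewrite restr0_deg1M ?mem0v.
rewrite restr_deg1M //; apply/memv_imgP; exists (restr (homog d) y); rewrite ?memvf //.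
by rewrite lfunE.
Qed.

Lemma regular_mod_cap0 : (L' :&: supp K (homog 0) = L :&: supp K (homog 0))%VS.
Proof.
apply/eqP; rewrite eqEsubv andbC capvS ?addvSl //=; apply/subvP => x.
rewrite !memv_cap => /andP[/memv_addP[u Lu [w /memv_imgP[y _ ->] ->]]] x0.
rewrite x0 andbT -(restr_id x0) linearD /= lfunE /= restr0_deg1M // addr0.
exact: L_graded.
Qed.

Lemma regular_mod_capS d : (L' :&: supp K (homog d.+1) =
  L :&: supp K (homog d.+1) + amull v @: supp K (homog d))%VS.
Proof.
apply/eqP; rewrite eqEsubv; apply/andP; split; apply/subvP => x.
  rewrite !memv_cap => /andP[/memv_addP[u Lu [w /memv_imgP[y _ ->] ->]]] xd.
  rewrite -(restr_id xd) linearD /= lfunE /= restr_deg1M //; apply: memv_add.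
    by rewrite memv_cap L_graded // restr_supp.
  by apply/memv_imgP; exists (restr (homog d) y); rewrite ?restr_supp // lfunE.
move=> /memv_addP[u /[!memv_cap] /andP[Lu ud] [w /memv_imgP[y yd ->] ->]].
apply/andP; split.
  by apply: memv_add => //; apply: memv_img; apply: memvf.
by rewrite memvD // lfunE /= -(restr_id yd) -restr_deg1M // restr_supp.
Qed.

Lemma regular_mod_capI d :
  (L :&: supp K (homog d.+1) :&: (amull v @: supp K (homog d)) =
   amull v @: (L' :&: supp K (homog d)))%VS.
Proof.
apply/eqP; rewrite eqEsubv; apply/andP; split; apply/subvP => x.
  rewrite !memv_cap => /andP[/andP[Lx _] /memv_imgP[y yd eqx]].
  apply/memv_imgP; exists y => //; rewrite memv_cap yd andbT -v_reg.
  by rewrite eqx lfunE in Lx.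
move=> /memv_imgP[y /[!memv_cap] /andP[L'y yd] ->]; rewrite memv_img // andbT.
by rewrite lfunE /= v_reg L'y -(restr_id yd) -restr_deg1M // restr_supp.
Qed.

(** This is [H_L = (1 + t) H_L'] in degree [d.+1]. There [L'] is the sum of [L] and [v E_d], which
    by regularity meet in [v L'_d]; rank-nullity concludes, as the kernel of [v] lies in [L']. *)
Lemma quot_dim_regular d : quot_dim L d.+1 = quot_dim L' d.+1 + quot_dim L' d.
Proof.
have ker_sub : (lker (amull v) <= L')%VS.
  by apply/subvP => x; rewrite memv_ker lfunE /= => /eqP vx; rewrite -v_reg vx mem0v.
rewrite /quot_dim regular_mod_capS.
have := dimv_sum_cap (L :&: supp K (homog d.+1)) (amull v @: supp K (homog d)).
rewrite regular_mod_capI.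
have := limg_ker_dim (amull v) (supp K (homog d)).
have := limg_ker_dim (amull v) (L' :&: supp K (homog d)).
rewrite (capvC L') -capvA (capv_idPr ker_sub) (capvC _ L').
move: (\dim (supp K (homog d) :&: lker _)) (\dim (_ @: (L' :&: _))) (\dim (L' :&: _)).
move: (\dim (_ + _)) (\dim (_ @: _)) (\dim (L :&: _)) (\dim (supp K (homog d))); lia.
Qed.

Lemma quot_dim_regular0 : quot_dim L 0 = quot_dim L' 0.
Proof. by rewrite /quot_dim regular_mod_cap0. Qed.

End RegularElement.

(** The partial sums of [(1 + t) B] at [t = -1] telescope to one boundary term. *)
Lemma alternating_sum_shift (a b : nat -> int) m : a 0%N = b 0%N ->
  (forall d, a d.+1 = b d.+1 + b d) ->
  \sum_(d < m.+1) (-1) ^+ d * a d = (-1) ^+ m * b m.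
Proof.
move=> ab0 abS; elim: m => [|m IHm]; first by rewrite big_ord1 ab0.
by rewrite big_ord_recr /= IHm abS exprS; ring.
Qed.

(** For [A = (1 + t) B] one has [A'(-1) = B(-1)]; this is the truncated form, with its boundary
    term. *)
Lemma alternating_wsum_shift (a b : nat -> int) m : a 0%N = b 0%N ->
  (forall d, a d.+1 = b d.+1 + b d) ->
  \sum_(d < m.+1) (-1) ^+ d * d%:Z * a d =
  (-1) ^+ m * m%:Z * b m - \sum_(d < m) (-1) ^+ d * b d.
Proof.
move=> ab0 abS; elim: m => [|m IHm]; first by rewrite big_ord1 big_ord0 /= !mulr0 !mul0r subr0.
by rewrite big_ord_recr [in RHS]big_ord_recr /= IHm abS exprS -addn1 PoszD; ring.
Qed.

(* The Hilbert series is divisible by [(1 + t)^2], so its derivative vanishes at [-1]. *)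
Lemma quot_dim_regular2 L v w : card_graded L -> ext_deg1 v -> ext_deg1 w ->
  regular_mod L v -> regular_mod (L + limg (amull v)) w ->
  \sum_(d < n.+1) (-1) ^+ d * d%:Z * quot_dim L d = 0.
Proof.
move=> grL v1 w1 vL wL; set L1 := (L + _)%VS in wL; set L2 := (L1 + limg (amull w))%VS.
have grL1 : card_graded L1 by exact: regular_mod_graded.
have sumL1 : \sum_(d < n.+1) (-1) ^+ d * quot_dim L1 d = 0.
  rewrite (alternating_sum_shift _ (quot_dim_regular0 grL1 w1) (quot_dim_regular grL1 w1 wL)).
  (* In degree [n.+1] both Hilbert functions vanish, so the recursion kills the one of [L2] in
     degree [n]. *)
  have := quot_dim_regular grL1 w1 wL n.
  by rewrite !(quot_dim_gt _ (ltnSn n)) add0r => <-; rewrite mulr0.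
(* Summing up to [n.+1] instead of [n] makes the boundary term vanish. *)
have := alternating_wsum_shift n.+1 (quot_dim_regular0 grL v1) (quot_dim_regular grL v1 vL).
by rewrite big_ord_recr /= !(quot_dim_gt _ (ltnSn n)) !mulr0 addr0 sumL1 subr0.
Qed.

End Hilbert.

(** * Regularity on [E/J] in terms of subspaces of [E] *)

Section OSRegular.
Local Open Scope quotient_scope.
Variables (K : fieldType) (n : nat) (M : matroid n).
Local Notation E := (exterior K n).
Local Notation N := (OS_algebra K M).
Local Notation J := (OS_ideal K M).
Local Notation pi := (fun x : E => \pi_(quot_by (OS_relations K M)) x : N).
Implicit Types (v x y : E) (vs : seq E).

(** The preimage in [E] of the submodule generated by [vs] in [E/J], as a subspace so that
    dimensions apply. *)
Definition seq_ideal vs : {vspace E} := (J + \sum_(i < size vs) limg (amull vs`_i))%VS.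

Lemma seq_ideal_nil : seq_ideal [::] = J.
Proof. by rewrite /seq_ideal big_ord0 addv0. Qed.

Lemma seq_ideal_rcons vs v : seq_ideal (rcons vs v) = (seq_ideal vs + limg (amull v))%VS.
Proof.
rewrite /seq_ideal size_rcons big_ord_recr /= addvA nth_rcons ltnn eqxx.
by congr (_ + _ + _)%VS; apply: eq_bigr => i _; rewrite nth_rcons ltn_ord.
Qed.

Lemma pi_sum (I : finType) (F : I -> E) : pi (\sum_i F i) = \sum_i pi (F i).
Proof.
apply: (big_morph pi) => [x y|]; first exact: quot_by_piD.
by apply: (@addrI _ (pi 0)); rewrite addr0 -quot_by_piD addr0.
Qed.

Lemma seq_mulmodP vs x : seq_mulmod vs (pi x) <-> x \in seq_ideal vs.
Proof.
split=> [[y]|/memv_addP[u Ju [w /memv_sumP[z zi ->] ->]]].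
  have -> : \sum_(i < size vs) vs`_i *: y i = pi (\sum_(i < size vs) vs`_i * repr (y i)).
    rewrite pi_sum; apply: eq_bigr => i _; rewrite -{1}[y i]quot_by_reprK.
    exact: quot_by_scale_pi.
  move/eqP; rewrite quot_by_eq => Jx; rewrite -[x](subrK (\sum_(i < size vs) vs`_i * repr (y i))).
  apply: memv_add => //; apply: memv_sumr => i _; apply/memv_imgP.
  by exists (repr (y i)); rewrite ?memvf // lfunE.
have {}zi (i : 'I_(size vs)) : exists y, z i = vs`_i * y.
  by have /memv_imgP[y _ ->] := zi i isT; exists y; rewrite lfunE.
have [y zy] := fin_all_exists zi; exists (fun i => pi (y i)).
have -> : \sum_(i < size vs) vs`_i *: pi (y i) = pi (\sum_i z i).
  by rewrite pi_sum; apply: eq_bigr => i _; rewrite zy; apply: quot_by_scale_pi.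
by apply/eqP; rewrite quot_by_eq addrK.
Qed.

Lemma regular_on_quotP vs v :
  regular_on_quot (seq_mulmod (N := N) vs) v <-> regular_mod (seq_ideal vs) v.
Proof.
have ex x : (exists y : N, seq_mulmod vs (pi x - v *: y)) <->
    x \in (seq_ideal vs + limg (amull v))%VS.
  split=> [[y]|/memv_addP[u Lu [w /memv_imgP[y _ ->] ->]]].
    have -> : pi x - v *: y = pi (x - v * repr y).
      rewrite -{1}[y]quot_by_reprK; apply: (@addIr _ (v *: pi (repr y))).
      rewrite subrK; have -> : v *: pi (repr y) = pi (v * repr y) by apply: quot_by_scale_pi.
      by rewrite -quot_by_piD subrK.
    move/seq_mulmodP => Lx; rewrite -[x](subrK (v * repr y)); apply: memv_add => //.
    by apply/memv_imgP; exists (repr y); rewrite ?memvf // lfunE.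
  exists (pi y); have -> : pi (u + amull v y) - v *: pi y = pi u.
    have -> : v *: pi y = pi (v * y) by apply: quot_by_scale_pi.
    by rewrite lfunE /= quot_by_piD addrK.
  exact/seq_mulmodP.
have scale_pi x : v *: pi x = pi (v * x) by apply: quot_by_scale_pi.
split=> reg x.
  have := reg (pi x); rewrite scale_pi => regx.
  by apply/idP/idP => [/seq_mulmodP/regx/ex|/ex/regx/seq_mulmodP].
suff H z : seq_mulmod vs (v *: pi z) <-> exists y : N, seq_mulmod vs (pi z - v *: y).
  by rewrite -[x]quot_by_reprK; apply: H.
rewrite scale_pi; split=> [/seq_mulmodP|/ex]; first by rewrite reg => /ex.
by rewrite -reg => /seq_mulmodP.
Qed.

End OSRegular.

(** * Depth *)

Section OSDepth.
Local Open Scope quotient_scope.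
Variables (K : fieldType) (n : nat) (M : matroid n).
Hypothesis noloop : loopless M.
Local Notation E := (exterior K n).
Local Notation N := (OS_algebra K M).
Local Notation regular := (@regular_seq K n N).
Implicit Types (v w x : E) (vs : seq E).

Lemma ext_deg1_gen i : ext_deg1 (ext_gen K i : E).
Proof.
by move=> S; rewrite ffunE; have [->|_] := eqVneq S [set i]; rewrite ?cards1 ?eqxx.
Qed.

(** Neither [J], for want of loops, nor a multiple of a degree 1 element has a constant term. Hence
    [1] survives in every quotient, and nontriviality is automatic. *)
Lemma seq_ideal_set0 vs x : (forall i, (i < size vs)%N -> ext_deg1 vs`_i) ->
  x \in seq_ideal M vs -> x set0 = 0.
Proof.
move=> vs1 /memv_addP[u Ju [w /memv_sumP[z zi ->] ->]].
rewrite extD (OS_ideal_set0 noloop Ju) add0r sum_ffunE big1 // => i _.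
have /memv_imgP[y _ ->] := zi i isT; rewrite lfunE /= ext_mul_set0.
have [->|/(vs1 i (ltn_ord i))] := eqVneq (vs`_i set0) 0; first exact: mul0r.
by rewrite cards0.
Qed.

Lemma one_notin_seq_ideal vs : (forall i, (i < size vs)%N -> ext_deg1 vs`_i) ->
  1 \notin seq_ideal M vs.
Proof.
move=> vs1; apply/negP => /(seq_ideal_set0 vs1); rewrite ext1 eqxx => /eqP.
by rewrite oner_eq0.
Qed.

Lemma regular_nil : regular [::].
Proof.
split=> //; exists (\pi_(quot_by (OS_relations K M)) 1) => /seq_mulmodP.
by apply/negP/one_notin_seq_ideal.
Qed.

Lemma regular_rconsP vs v :
  regular (rcons vs v) <-> [/\ regular vs, ext_deg1 v & regular_mod (seq_ideal M vs) v].
Proof.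
have nontrivial us : (forall i, (i < size us)%N -> ext_deg1 us`_i) ->
    exists x : N, ~ seq_mulmod us x.
  move=> us1; exists (\pi_(quot_by (OS_relations K M)) 1) => /seq_mulmodP.
  exact/negP/one_notin_seq_ideal.
have takeE i : (i <= size vs)%N -> take i (rcons vs v) = take i vs.
  by move=> le_i; rewrite -cats1 takel_cat.
split=> [[reg _]|[[reg _] v1 /regular_on_quotP vreg]].
  have [] := reg (size vs); first by rewrite size_rcons.
  rewrite takeE // take_size nth_rcons ltnn eqxx => v1 /regular_on_quotP vreg.
  have {}reg i : (i < size vs)%N ->
      ext_deg1 vs`_i /\ regular_on_quot (seq_mulmod (N := N) (take i vs)) vs`_i.
    move=> lt_i; have := reg i; rewrite size_rcons nth_rcons lt_i takeE ?(ltnW lt_i) //.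
    by apply; apply: ltnW.
  by split=> //; split=> //; apply: nontrivial => i /reg[].
have {}reg i : (i < size (rcons vs v))%N -> ext_deg1 (rcons vs v)`_i /\
    regular_on_quot (seq_mulmod (N := N) (take i (rcons vs v))) (rcons vs v)`_i.
  rewrite size_rcons ltnS leq_eqVlt nth_rcons => /orP[/eqP ->|lt_i].
    by rewrite ltnn eqxx takeE // take_size.
  by rewrite lt_i takeE ?(ltnW lt_i) //; apply: reg.
by split=> //; apply: nontrivial => i /reg[].
Qed.

Lemma regular_deg1 vs : regular vs -> forall i, (i < size vs)%N -> ext_deg1 vs`_i.
Proof. by case=> reg _ i /reg[]. Qed.

(** Each regular element enlarges the subspace: if [v * 1] already lay in it, regularity would put
    [1] in the next one. This bounds the length of regular sequences. *)
Lemma regular_size vs : regular vs -> (size vs <= \dim (seq_ideal M vs))%N.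
Proof.
elim/last_ind: vs => // vs v IHvs reg; have /regular_rconsP[/IHvs le _ vreg] := reg.
rewrite size_rcons; apply: leq_ltn_trans le _.
have sub : (seq_ideal M vs <= seq_ideal M (rcons vs v))%VS.
  by rewrite seq_ideal_rcons addvSl.
rewrite ltn_neqAle dimvS // andbT; apply/negP => eq_dim.
have eqL : seq_ideal M vs = seq_ideal M (rcons vs v).
  by apply/eqP; rewrite eqEdim sub (eqP eq_dim) /=.
have := one_notin_seq_ideal (regular_deg1 reg).
rewrite seq_ideal_rcons -vreg eqL seq_ideal_rcons -[v * 1]add0r memv_add ?mem0v //.
by apply/memv_imgP; exists 1; rewrite ?memvf // lfunE.
Qed.

Lemma regular2_beta v w vs : regular [:: v, w & vs] -> beta M = 0.
Proof.
case=> reg _; have [v1 /regular_on_quotP] := reg 0%N isT.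
rewrite /= seq_ideal_nil => vreg; have [w1 /regular_on_quotP] := reg 1%N isT.
rewrite /= -[[:: v]]/(rcons [::] v) seq_ideal_rcons seq_ideal_nil => wreg.
rewrite /beta (crapo_quot_dim K noloop) (quot_dim_regular2 _ v1 w1 vreg wreg) ?mulr0 //.
by move=> d x; apply: OS_graded_card.
Qed.

Lemma regular_gen i : regular [:: ext_gen K i].
Proof.
apply/(regular_rconsP [::]); split; [exact: regular_nil | exact: ext_deg1_gen |].
rewrite seq_ideal_nil => x.
apply: (@ext_gen_regular _ _ _ (fun=> 1)) => //; first exact: intprod1_ideal.
by move=> y; apply: OS_idealMl.
Qed.

(** The indicator of [X] vanishes at [j], so its interior product preserves the multiples of [e_j]
    as well as [J]; it is 1 at [i], which gives the homotopy for [e_i] modulo both. *)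
Lemma regular_separated X i j : separates (rank M) [set: 'I_n] X -> i \in X -> j \notin X ->
  regular [:: ext_gen K j; ext_gen K i].
Proof.
move=> sepX Xi nXj; apply/(regular_rconsP [:: ext_gen K j]).
split; [exact: regular_gen | exact: ext_deg1_gen |].
rewrite -[[:: _]]/(rcons [::] (ext_gen K j)) seq_ideal_rcons seq_ideal_nil => x.
apply: (@ext_gen_regular _ _ _ (fun k => (k \in X)%:R)) => [|y|y]; first by rewrite Xi.
  move=> /memv_addP[u Ju [_ /memv_imgP[z _ ->] ->]]; rewrite linearD /=.
  rewrite memv_add ?(intprod_sep_ideal sepX) //; apply/memv_imgP.
  exists (- intprod (fun k => (k \in X)%:R) z); rewrite ?memvf // !lfunE /=.
  by rewrite intprod_genM (negPf nXj) scale0r add0r mulrN.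
move=> /memv_addP[u Ju [_ /memv_imgP[z _ ->] ->]]; rewrite mulrDr.
rewrite memv_add ?OS_idealMl //; apply/memv_imgP.
exists (- (ext_gen K i * z)); rewrite ?memvf // !lfunE /=.
by rewrite ext_gen_anticomm mulrN.
Qed.

(** Lengths being bounded, [vs] would extend to a maximal regular sequence of length greater than
    1. *)
Lemma depth1_no_regular2 vs : depth_eq N 1 -> regular vs -> ~ (1 < size vs)%N.
Proof.
case=> _ max1 reg gt1; have [m] := ubnP (\dim {:E} - size vs).
elim: m vs reg gt1 => // m IHm vs reg gt1 ltm.
suff /max1 size1 : maximal_regular_seq N vs by rewrite size1 in gt1.
split=> // v regv; have := regular_size regv; have := dimvS (subvf (seq_ideal M (rcons vs v))).
rewrite size_rcons => le1 le2; apply: (IHm _ regv); rewrite size_rcons.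
  exact: ltnW.
move: ltm; have : (size vs < \dim {:E})%N := leq_trans le2 le1.
by move: (\dim _) => D; lia.
Qed.
End OSDepth.

Theorem theorem6p4 (K : fieldType)
    (K_infinite : forall s : seq K, exists x : K, x \notin s)
    (n : nat) (M : matroid n) (M_loopless : loopless M) :
  depth_eq (OS_algebra K M) 1%N <-> beta M != 0.
Proof.
split=> [depth1|beta0].
  apply/eqP => beta0; have [n0|n_gt0] := posnP n.
    (* For [n = 0] the only element of degree 1 is [0], which is not regular, so no regular sequence
       has length 1. *)
    have [[vs maxvs] max1] := depth1; have := max1 vs maxvs.
    case: maxvs => reg _; case: vs reg => [|v [|]] // reg _.
    have /(regular_rconsP M_loopless [::])[_ v1 vreg] := reg.
    have v0 : v = 0.
      rewrite (ext_deg1_sum v1) big1 // => i; have := ltn_ord i.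
      by rewrite [X in (_ < X)%N]n0.
    have := one_notin_seq_ideal M_loopless (regular_deg1 reg).
    rewrite -[[:: v]]/(rcons [::] v) seq_ideal_rcons -vreg v0 mul0r => /negP[].
    exact: mem0v.
  have [X sepX] := beta_eq0_separates M_loopless n_gt0 beta0.
  have /and4P[_ /set0Pn[i Xi] XT _] := sepX.
  have [j nXj] : exists j, j \notin X.
    apply/existsP; rewrite -negb_forall; apply: contra XT => /forallP XT.
    by apply/eqP/setP => j; rewrite XT inE.
  have reg := regular_separated K M_loopless sepX Xi nXj.
  exact: (depth1_no_regular2 M_loopless depth1 reg).
have n_gt0 : (0 < n)%N.
  rewrite lt0n; apply: contraNneq beta0 => n0; rewrite /beta big1 ?mulr0 // => S _.
  have -> : S = set0.
    by apply/setP => i; have := ltn_ord i; rewrite [X in (_ < X)%N]n0.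
  by rewrite rank0 mulr0.
have reg1 := regular_gen K M_loopless (Ordinal n_gt0).
have le2 vs : @regular_seq K n (OS_algebra K M) vs -> (size vs <= 1)%N.
  case: vs => [|v [|w vs]] // reg.
  by rewrite (regular2_beta M_loopless reg) eqxx in beta0.
split=> [|vs [reg maxvs]].
  by exists [:: ext_gen K (Ordinal n_gt0)]; split=> // v /le2.
(* The empty sequence is not maximal, as a generator extends it. *)
apply/eqP; rewrite eqn_leq le2 // lt0n size_eq0; apply/eqP => vs0.
by apply: (maxvs (ext_gen K (Ordinal n_gt0))); rewrite vs0.
Qed.
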